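(* Let $G$ be a countable group and $\mu$ a probability measure on $G$ with finite entropy $H(\mu)<\infty$. Let $\tau$ be a randomized Markov stopping time for the random walk $(G,\mu)$. If the expectation $\mathbf{E}(\tau)$ is finite, then $$h(\mu_\tau)=\mathbf{E}(\tau)\,h(\mu).$$
   Context: Entropy. For a probability measure $\rho$ on the countable group $G$, $H(\rho)=-\sum_{g\in G}\rho(g)\log\rho(g)$ (with $0\log 0=0$), and the asymptotic entropy is $h(\rho)=\lim_{n\to\infty}\frac1n H(\rho^{*n})$, where $\rho^{*n}$ is the $n$-fold convolution power (the limit exists by subadditivity). Random walk. The random walk $(G,\mu)$ issued from the identity $e$ has positions $x_0=e$, $x_n=h_1h_2\cdots h_n$, where the increments $h_1,h_2,\dots$ are independent and identically $\mu$-distributed. Randomized Markov stopping time. Let $(\Omega,\theta)$ be a Lebesgue (standard) probability space. The extended chain is $(\boldsymbol{x},\boldsymbol{\omega})=((e,\omega_0),(x_1,\omega_1),(x_2,\omega_2),\dots)$, where $(x_n)$ is the random walk $(G,\mu)$ from $e$ and $\omega_0,\omega_1,\dots$ are i.i.d. $\theta$-distributed and independent of $(x_n)$; equivalently, it is the Markov chain on $G\times\Omega$ with transition probabilities $\pi_{(g,\omega)}=\sum_{h}\mu(h)\,\delta_{gh}\otimes\theta$ and initial distribution $\delta_e\otimes\theta$. Let $\mathbf{P}$ be its law on the path space and $\mathbf{E}$ the expectation. A randomized Markov stopping time is a measurable function $\tau$ on the path space of the extended chain with values in $\mathbb{N}=\{1,2,\dots\}$, finite almost everywhere, such that for every $s\in\mathbb{N}$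 the event $\{\tau=s\}$ belongs to the $\sigma$-algebra generated by $(x_0,\omega_0),\dots,(x_s,\omega_s)$. The transformed measure $\mu_\tau$ is the distribution of $x_\tau$: $\mu_\tau(g)=\mathbf{P}\{(\boldsymbol{x},\boldsymbol{\omega}): x_\tau=g\}$ for $g\in G$. *)

(* Defs.v *)
From HB Require Import structures.
From mathcomp Require Import all_boot all_order all_algebra.
From mathcomp Require Import all_classical all_reals all_analysis.
From mathcomp Require Import measurable_realfun.

Set Implicit Arguments.
Unset Strict Implicit.
Unset Printing Implicit Defensive.

Import Order.TTheory GRing.Theory Num.Theory.
Import numFieldNormedType.Exports.

Local Open Scope classical_set_scope.
Local Open Scope ring_scope.
Local Open Scope ereal_scope.

(* A probability measure on a countable group is given by its mass function. *)
Section mass_functions.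
Context {R : realType} {G : groupType}.
Implicit Types rho sigma : G -> R.

Definition prob_mass rho : Prop :=
  (forall g, (0 <= rho g)%R) /\ \esum_(g in [set: G]) (rho g)%:E = 1.

(* [ln 0 = 0], so that a null atom contributes 0; the sum may be [+oo]. *)
Definition entropy rho : \bar R :=
  \esum_(g in [set: G]) (- (rho g * ln (rho g)))%:E.

Definition convolution rho sigma : G -> R := fun g =>
  fine (\esum_(h in [set: G]) (rho h * sigma (h^-1 * g)%g)%:E).

Definition dirac_mass (a : G) : G -> R := fun g => ((g == a)%:R)%R.

Fixpoint conv_pow rho (n : nat) : G -> R :=
  if n is m.+1 then convolution (conv_pow rho m) rho else dirac_mass 1%g.

(* The term of index 0 is 0 and irrelevant to the limit. *)
Definition asymptotic_entropy rho : \bar R :=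
  limn (fun n => (n%:R^-1)%:E * entropy (conv_pow rho n)).

End mass_functions.

(* Both spaces are considered up to completion: the image (preimage) of a
   measurable set is only required to be measurable up to a negligible set. So
   [T] itself may or may not be complete. *)
Definition isomorphic_mod0 {R : realType} {d1 d2 : measure_display}
    {T : measurableType d1} {U : measurableType d2}
    (m : {measure set T -> \bar R}) (n : {measure set U -> \bar R}) : Prop :=
  exists (A : set T) (B : set U) (f : T -> U),
    [/\ measurable A /\ m (~` A) = 0,
        measurable B /\ n (~` B) = 0,
        set_bij A B f,
        (forall E, measurable E -> E `<=` A ->
           exists F, [/\ measurable F, n F = m E
                       & n.-negligible ((f @` E) `+` F)])
      & (forall F, measurable F -> F `<=` B ->
           exists E, [/\ measurable E, m E = n F
                       & m.-negligible ((A `&` f @^-1` F) `+` E)])].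

(* The model space is the interval [0, c] with Lebesgue measure, together with
   atoms of mass [w k] placed at the points [- k.+1]. *)
Definition lebesgue_space {R : realType} {d : measure_display}
    {Omega : measurableType d} (theta : probability Omega R) : Prop :=
  exists (c : R) (w : nat -> R)
         (nu : {measure set (measurableTypeR R) -> \bar R}),
    [/\ (0 <= c)%R, (forall k, (0 <= w k)%R),
        (forall B, measurable B ->
           nu B = lebesgue_measure (B `&` `[0%R, c])
                  + \sum_(0 <= k <oo) (w k)%:E * \d_((- k.+1%:R)%R : R) B)
      & isomorphic_mod0 theta nu].

Section path_space.
Context {d : measure_display} (S : measurableType d).

Definition path_coord (n : nat) : (nat -> S) -> S := fun x => x n.

Definition path_coord_events (n : nat) : set (set (nat -> S)) :=
  preimage_set_system setT (path_coord n) measurable.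

Definition path_events : set (set (nat -> S)) := \bigcup_n path_coord_events n.

Definition path_filtration (s : nat) : set (set (nat -> S)) :=
  <<s \bigcup_(n in [set n | (n <= s)%N]) path_coord_events n >>.

(* Time-homogeneous Markov property with respect to the natural filtration;
   together with the initial distribution it determines [P]. *)
Definition markov_law {R : realType} (init : set S -> \bar R)
    (K : S -> set S -> \bar R)
    (P : probability (g_sigma_algebraType path_events) R) : Prop :=
  (forall B, measurable B -> P (path_coord 0 @^-1` B) = init B) /\
  (forall s C B, path_filtration s C -> measurable B ->
     P (C `&` path_coord s.+1 @^-1` B) = \int[P]_(x in C) K (x s) B).

End path_space.

Arguments path_events {d} S.

Notation path_space S := (g_sigma_algebraType (path_events S)).

(* Copy of [G] carrying the discrete sigma-algebra. *)
Definition discrete_group (G : groupType) : Type := G.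

Section discrete_group.
Variable G : groupType.
HB.instance Definition _ := Group.on (discrete_group G).
HB.instance Definition _ := isPointed.Build (discrete_group G) 1%g.
HB.instance Definition _ := @isMeasurable.Build default_measure_display
  (discrete_group G) (@discrete_measurable (discrete_group G))
  (@discrete_measurable0 (discrete_group G))
  (@discrete_measurableC (discrete_group G)) (@discrete_measurableU (discrete_group G)).
End discrete_group.

Notation ext_state G Omega := (discrete_group G * Omega)%type.
Notation ext_path G Omega := (path_space (ext_state G Omega)).

Section extended_walk.
Context {R : realType} {G : groupType} {d : measure_display}
        {Omega : measurableType d}.

Definition ext_init (theta : probability Omega R) :
    set (ext_state G Omega) -> \bar R :=
  (\d_(1%g : discrete_group G) \x theta)%E.

(* pi_(g, w) = \sum_h mu(h) (delta_(g h) (x) theta) *)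
Definition ext_transition (mu : G -> R) (theta : probability Omega R)
    (z : ext_state G Omega) (B : set (ext_state G Omega)) : \bar R :=
  \esum_(h in [set: G]) (mu h)%:E * (\d_((z.1 * h)%g : discrete_group G) \x theta)%E B.

End extended_walk.

Section stopping_times.
Context {R : realType} {G : groupType} {d : measure_display}
        {Omega : measurableType d}.
Variable P : probability (ext_path G Omega) R.

(* Times are extended reals so that E(tau) is a library integral; the value
   [+oo] is allowed, on a null set. *)
Definition randomized_stopping_time (tau : ext_path G Omega -> \bar R) : Prop :=
  [/\ measurable_fun setT tau,
      (forall x, tau x = +oo \/ exists2 s : nat, (0 < s)%N & tau x = s%:R%:E),
      {ae P, forall x, tau x < +oo}
    & forall s : nat, (0 < s)%N ->
        path_filtration s (tau @^-1` [set s%:R%:E])].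

Definition stopped_mass (tau : ext_path G Omega -> \bar R) : G -> R :=
  fun g => fine (P [set x | exists2 s : nat, tau x = s%:R%:E & (x s).1 = g]).

End stopping_times.

(* Main.v *)
(* Record the walk by words: [w] is the word of increments up to time [tau], so
   that [mu_tau] is the law of the product of [w] and [mu_tau^{*n}] the law of
   the product of the concatenation of [n] independent copies of [w]. Prolonging
   such a concatenation by independent [mu]-letters couples [mu_tau^{*n}] with
   [mu^{*k}]: the two group elements differ by a word whose length is the gap
   between [k] and the sum [S_n] of [n] independent copies of [tau]. By Gibbs'
   inequality and Wald's identity such a word carries an entropy at most
   [c + K E|S_n - k|], hence
     |H(mu_tau^{*n}) - H(mu^{*k})| <= c + K E|S_n - k|.
   For [k] close to [n E(tau)] the right-hand side is [o(n)] by the law of large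
   numbers in mean, and dividing by [n] gives the theorem. *)
Require Import Defs.
From HB Require Import structures.
From mathcomp Require Import all_boot all_order all_algebra.
From mathcomp Require Import all_classical all_reals all_analysis.
From mathcomp Require Import measurable_realfun.
From mathcomp Require Import lra ring zify.

Set Implicit Arguments.
Unset Strict Implicit.
Unset Printing Implicit Defensive.

Import Order.TTheory GRing.Theory Num.Theory.
Import numFieldNormedType.Exports.

Local Open Scope classical_set_scope.
Local Open Scope ring_scope.
Local Open Scope ereal_scope.

(** * Positive functionals and countable sums *)

(** The sum [S_n] may overshoot [k] or fall short of it. One coupling treats both cases: the
    concatenation [w] is cut at length [k], and what is left is completed to length [k] by fresh
    letters [v]. That the completed word is a [mu]-walk of length [k] is where the stopping property
    enters; it is kept as a property of the law of the word, stable under concatenation. The joint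
    law of the discrepancy [(drop k w, v)] depends on the stopping rule and is out of reach, but
    Gibbs' inequality only asks for some fixed subprobability on words. A weight multiplicative in
    the letters turns the bound into an additive cost, to which Wald's identity applies; hence
    [K = ln 2 + H(mu)], and each of the two words contributes [ln 2] to [c]. Only the first moment
    of [tau] is finite, so the law of large numbers in mean goes through truncation instead of a
    variance. Independent copies are iterations of one positive functional, so no infinite product
    of path spaces is formed. *)

Section expectation.
Context {R : realType}.

Lemma esum_ge_point (X : choiceType) (a : X -> \bar R) x :
  (forall x, 0 <= a x) -> a x <= \esum_(x in [set: X]) a x.
Proof.
move=> a0; rewrite -[leLHS]esum_set1// esum_mkcond; apply: le_esum => y _.
by case: ifP.
Qed.

(** For real [c > 0] one inequality is the other one applied to [c^-1]; for [c = +oo] a single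
    positive term makes both sides infinite. *)
Lemma esumZl (X : choiceType) (c : \bar R) (a : X -> \bar R) :
  0 <= c -> (forall x, 0 <= a x) ->
  \esum_(x in [set: X]) c * a x = c * \esum_(x in [set: X]) a x.
Proof.
move=> c0 a0.
have le_real (k : R) (b : X -> \bar R) : (0 <= k)%R -> (forall x, 0 <= b x) ->
    \esum_(x in [set: X]) k%:E * b x <= k%:E * (\esum_(x in [set: X]) b x).
  move=> k0 b0; apply: ge_ereal_sup => _ [A [finA _] <-].
  rewrite -ge0_mule_fsumr//; apply: lee_wpmul2l; first by rewrite lee_fin.
  by apply: ereal_sup_ubound; exists A.
have ge_real (k : R) : (0 < k)%R ->
    (k%:E * (\esum_(x in [set: X]) a x) <= \esum_(x in [set: X]) k%:E * a x)%E.
  move=> k0.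
  have -> : \esum_(x in [set: X]) a x
      = \esum_(x in [set: X]) (k^-1)%:E * (k%:E * a x).
    by apply: eq_esum => x _; rewrite muleA -EFinM mulVf ?gt_eqF// mul1e.
  have h : \esum_(x in [set: X]) (k^-1)%:E * (k%:E * a x)
      <= (k^-1)%:E * (\esum_(x in [set: X]) k%:E * a x).
    apply: le_real => [|x]; first by rewrite invr_ge0 ltW.
    by rewrite mule_ge0// lee_fin ltW.
  have k0' : 0 <= k%:E by rewrite lee_fin ltW.
  apply: le_trans (lee_wpmul2l k0' h) _.
  by rewrite muleA -EFinM mulfV ?gt_eqF// mul1e.
case: c c0 => [k|_|//].
  rewrite lee_fin le_eqVlt => /predU1P[<-|k0].
    by rewrite mul0e esum1// => x _; rewrite mul0e.
  by apply/eqP; rewrite eq_le le_real ?(ltW k0)//= ge_real.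
have [allz|/existsNP[x /eqP ax]] := pselect (forall x, a x = 0).
  rewrite !esum1 ?mule0// => x _; by rewrite ?allz ?mule0.
have axp : 0 < a x by rewrite lt_neqAle eq_sym ax a0.
rewrite [RHS]gt0_mulye; last exact: lt_le_trans axp (esum_ge_point x a0).
apply/eqP; rewrite eq_le leey/=.
apply: le_trans (esum_ge_point x _); first by rewrite gt0_mulye.
by move=> y; rewrite mule_ge0.
Qed.

Lemma esum_eq_op (X : choiceType) (x0 : X) (F : X -> \bar R) : 0 <= F x0 ->
  \esum_(x in [set: X]) (x0 == x)%:R%:E * F x = F x0.
Proof.
move=> F0; rewrite -[RHS]esum_set1// [RHS]esum_mkcond; apply: eq_esum => x _.
case: eqP => [<-|ne]; first by rewrite mul1e ifT// inE.
by rewrite mul0e ifF//; apply/negbTE/negP; rewrite inE/= => xx; apply: ne.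
Qed.

Lemma esum_swap (X Y : choiceType) (a : X -> Y -> \bar R) :
  (forall x y, 0 <= a x y) ->
  \esum_(x in [set: X]) \esum_(y in [set: Y]) a x y =
  \esum_(y in [set: Y]) \esum_(x in [set: X]) a x y.
Proof.
move=> a0; rewrite !esum_esum//.
rewrite (@reindex_esum _ _ _ ([set: Y] `*`` fun=> [set: X])
  ([set: X] `*`` fun=> [set: Y]) (fun p => (p.2, p.1)))//.
by split => [p _//|[? ?] [? ?] _ _ [-> ->]//|[x y] _]; exists (y, x).
Qed.

Lemma esum_pair (X Y : choiceType) (a : X * Y -> \bar R) :
  (forall p, 0 <= a p) ->
  \esum_(p in [set: X * Y]) a p =
  \esum_(x in [set: X]) \esum_(y in [set: Y]) a (x, y).
Proof.
move=> a0; rewrite esum_esum//; have -> : [set: X] `*`` (fun=> [set: Y]) = setT.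
  by apply/seteqP; split => // p _; split.
by apply: eq_esum => -[].
Qed.

Definition expect (X : choiceType) (a : X -> R) (F : X -> \bar R) : \bar R :=
  \esum_(x in [set: X]) (a x)%:E * F x.

(** Counterpart of [prob_mass] off groups: the law of the stopped word lives on [seq G]. *)
Definition is_mass (X : choiceType) (a : X -> R) : Prop :=
  (forall x, (0 <= a x)%R) /\ \esum_(x in [set: X]) (a x)%:E = 1.

(* Positive normalized functionals on nonnegative functions: they are closed
   under iteration, so that no mass function on words has to be written down. *)
Record is_expectation (X : Type) (J : (X -> \bar R) -> \bar R) : Prop :=
  Expectation {
    exp_mono : forall F F', (forall x, 0 <= F x) -> (forall x, F x <= F' x) ->
      J F <= J F';
    exp_add : forall F F', (forall x, 0 <= F x) -> (forall x, 0 <= F' x) ->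
      J (fun x => F x + F' x) = J F + J F';
    exp_scale : forall c F, 0 <= c -> (forall x, 0 <= F x) ->
      J (fun x => c * F x) = c * J F;
    exp_one : J (fun=> 1) = 1 }.

Section expectation_theory.
Context {X : Type} {J : (X -> \bar R) -> \bar R}.
Hypothesis eJ : is_expectation J.

Lemma exp_cst c : 0 <= c -> J (fun=> c) = c.
Proof.
move=> c0; have := exp_scale eJ (F := fun=> 1) c0 (fun=> lee01).
by rewrite (exp_one eJ) mule1.
Qed.

Lemma exp_eq_cst c F : 0 <= c -> (forall x, F x = c) -> J F = c.
Proof.
by move=> c0 Fc; rewrite -[RHS]exp_cst//; congr J; apply/funext.
Qed.

Lemma exp_ge0 F : (forall x, 0 <= F x) -> 0 <= J F.
Proof.
move=> F0; rewrite -[leLHS](@exp_cst 0)//; exact: (exp_mono eJ).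
Qed.
End expectation_theory.

Lemma expect_expectation (X : choiceType) (a : X -> R) :
  is_mass a -> is_expectation (expect a).
Proof.
move=> [a0 a1]; have aF0 F x : (forall x, 0 <= F x) -> 0 <= (a x)%:E * F x.
  by move=> F0; rewrite mule_ge0// lee_fin.
split => [F F' F0 FF'|F F' F0 F'0|c F c0 F0|].
- by apply: le_esum => x _; rewrite lee_wpmul2l// lee_fin.
- rewrite /expect -esumD; [|by move=> *; exact: aF0..].
  by apply: eq_esum => x _; rewrite ge0_muleDr.
- rewrite /expect -esumZl//; last by move=> x; exact: aF0.
  by apply: eq_esum => x _; rewrite muleCA.
- by rewrite -[RHS]a1; apply: eq_esum => x _; rewrite mule1.
Qed.

(** Takes the place of product measures: the inner functional may depend on the outer sample, and
    [f] merges the two samples. *)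
Lemma expectation_bind (X Y Z : Type) (J : (X -> \bar R) -> \bar R)
    (K : X -> (Y -> \bar R) -> \bar R) (f : X -> Y -> Z) :
  is_expectation J -> (forall x, is_expectation (K x)) ->
  is_expectation (fun F => J (fun x => K x (fun y => F (f x y)))).
Proof.
move=> eJ eK; split => [F F' F0 FF'|F F' F0 F'0|c F c0 F0|].
- by apply: (exp_mono eJ) => x; [exact: exp_ge0|exact: (exp_mono (eK x))].
- rewrite -(exp_add eJ); [|by move=> x; exact: exp_ge0..].
  by congr J; apply/funext => x; rewrite (exp_add (eK x)).
- rewrite -(exp_scale eJ)//; last by move=> x; exact: exp_ge0.
  by congr J; apply/funext => x; rewrite (exp_scale (eK x)).
- rewrite -[RHS](exp_one eJ); congr J; apply/funext => x; exact: exp_one.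
Qed.

End expectation.

(** * Gibbs' inequality *)

Section gibbs.
Context {R : realType}.

(* [- ln t], with the value [+oo] at the junk point [t = 0] of [ln]. *)
Definition nlog (t : R) : \bar R := if (0 < t)%R then (- ln t)%:E else +oo.

Lemma nlog_ge0 t : (t <= 1)%R -> 0 <= nlog t.
Proof. by rewrite /nlog => t1; case: ifP => // t0; rewrite lee_fin oppr_ge0 ln_le0. Qed.

Lemma nlogM s t : (0 <= s)%R -> (0 <= t)%R -> nlog (s * t) = nlog s + nlog t.
Proof.
rewrite /nlog !le_eqVlt => /predU1P[<-|s0] /predU1P[<-|t0];
  rewrite ?mul0r ?mulr0 ?ltxx//= ?s0 ?t0 ?mulr_gt0//.
by rewrite lnM// opprD EFinD.
Qed.

Lemma nlog_anti s t : (s <= t)%R -> nlog t <= nlog s.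
Proof.
rewrite /nlog => st; have [s0|_] := ltP 0%R s; last exact: leey.
by rewrite (lt_le_trans s0 st) lee_fin lerN2 ler_ln ?posrE// (lt_le_trans s0 st).
Qed.

Lemma mass_le1 (X : choiceType) (a : X -> R) x :
  (forall x, (0 <= a x)%R) -> \esum_(x in [set: X]) (a x)%:E <= 1 -> (a x <= 1)%R.
Proof.
move=> a0 a1; rewrite -lee_fin; apply: le_trans a1.
by apply: (@esum_ge_point _ _ (fun x => (a x)%:E)) => y; rewrite lee_fin.
Qed.

(** At a null atom the value [+oo] of [nlog] is absorbed by [0 * +oo = 0]. *)
Lemma entropyE (G : groupType) (rho : G -> R) : prob_mass rho ->
  entropy rho = expect rho (fun g => nlog (rho g)).
Proof.
move=> [rho0 _]; apply: eq_esum => g _; rewrite /nlog.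
have := rho0 g; rewrite le_eqVlt => /predU1P[<-|pos].
  by rewrite ltxx mul0r oppr0 mul0e.
by rewrite pos -EFinM mulrN.
Qed.

Lemma gibbs (G : groupType) (b Q : G -> R) : prob_mass b ->
  (forall g, (0 <= Q g)%R) -> \esum_(g in [set: G]) (Q g)%:E <= 1 ->
  entropy b <= expect b (fun g => nlog (Q g)).
Proof.
move=> bm Q0 Q1; rewrite entropyE//; have [b0 b1] := bm.
have ble1 g : (b g <= 1)%R by apply: mass_le1; rewrite ?b1.
have Qle1 g : (Q g <= 1)%R by exact: mass_le1.
have nb0 g : 0 <= (b g)%:E * nlog (b g).
  by rewrite mule_ge0 ?lee_fin ?nlog_ge0.
have nQ0 g : 0 <= (b g)%:E * nlog (Q g).
  by rewrite mule_ge0 ?lee_fin ?nlog_ge0.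
(* Adding 1 to both sides, as the mass of [b] on the left and as a bound for the mass of [Q] on the
   right, leaves the termwise claim [b nlog b + b <= b nlog Q + Q] and avoids subtracting infinite
   sums. *)
rewrite -(leeD2rE (x := 1))// /expect -{1}b1 -esumD//; last first.
  by move=> g _; rewrite lee_fin.
apply: le_trans (leeD2l _ Q1); rewrite -esumD//; last first.
  by move=> g _; rewrite lee_fin.
apply: le_esum => g _; have := b0 g; rewrite le_eqVlt => /predU1P[<-|bpos].
  by rewrite !mul0e !add0e lee_fin.
have := Q0 g; rewrite le_eqVlt => /predU1P[<-|Qpos].
  by rewrite {2}/nlog ltxx gt0_muley// addye// leey.
rewrite /nlog bpos Qpos -!EFinM -!EFinD lee_fin.
(* This is [ln t <= t - 1] at [t = Q g / b g]. *)
have := @le_ln1Dx R (Q g / b g - 1)%R.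
rewrite (addrC 1%R) subrK => h.
have {}h : (ln (Q g / b g) <= Q g / b g - 1)%R.
  by apply: h; rewrite ltrBDr addNr divr_gt0.
rewrite ln_div ?posrE// in h.
have := ler_wpM2l (ltW bpos) h.
rewrite !mulrBr mulr1 mulrCA divff ?gt_eqF// mulr1.
by move: (ln _) (ln _) => s t; lra.
Qed.

(** Gibbs' inequality for [beta] against the law [Q] of [m h y] with [h] and [y] drawn independently
    from [alpha] and [q]. The term [(A x, D x)] alone gives [Q (B x) >= alpha (A x) * q (D x)]. The
    law of [D] and its dependence on [A] never enter. *)
Lemma entropy_coupling (G : groupType) (X : Type) (Y : choiceType)
    (J : (X -> \bar R) -> \bar R) (alpha beta : G -> R) (q : Y -> R)
    (A B : X -> G) (D : X -> Y) (m : G -> Y -> G) :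
  is_expectation J -> prob_mass alpha -> prob_mass beta ->
  (forall y, (0 <= q y)%R) -> \esum_(y in [set: Y]) (q y)%:E <= 1 ->
  (forall F, (forall g, 0 <= F g) -> J (F \o A) = expect alpha F) ->
  (forall F, (forall g, 0 <= F g) -> J (F \o B) = expect beta F) ->
  (forall x, B x = m (A x) (D x)) ->
  entropy beta <= entropy alpha + J (fun x => nlog (q (D x))).
Proof.
move=> eJ am bm q0 q1 lawA lawB BE; have [a0 a1] := am.
have ale1 g : (alpha g <= 1)%R by apply: mass_le1; rewrite ?a1.
have qle1 y : (q y <= 1)%R by exact: mass_le1.
pose Qe g := expect alpha (fun h => expect q (fun y => (m h y == g)%:R%:E)).
have ind0 h y g : 0 <= (m h y == g)%:R%:E :> \bar R by rewrite lee_fin.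
have t0 h y g : 0 <= (alpha h)%:E * ((q y)%:E * (m h y == g)%:R%:E).
  by rewrite !mule_ge0 ?lee_fin.
have qi0 h g : 0 <= expect q (fun y => (m h y == g)%:R%:E).
  by apply: esum_ge0 => y _; rewrite !mule_ge0 ?lee_fin.
have QeE g : Qe g = \esum_(p in [set: G * Y])
    (alpha p.1)%:E * ((q p.2)%:E * (m p.1 p.2 == g)%:R%:E).
  rewrite esum_pair//; apply: eq_esum => h _ /=; rewrite esumZl ?lee_fin// => y.
  by rewrite mule_ge0 ?lee_fin.
have Qe0 g : 0 <= Qe g.
  by apply: esum_ge0 => h _; rewrite mule_ge0 ?lee_fin.
have sumQ : \esum_(g in [set: G]) Qe g <= 1.
  under eq_esum do rewrite QeE.
  rewrite esum_swap; last by move=> g [h y]; exact: t0.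
  under eq_esum => p _.
    under eq_esum do rewrite muleA muleC.
    rewrite esum_eq_op; last by rewrite mule_ge0 ?lee_fin.
    over.
  rewrite esum_pair/=; last by move=> p; rewrite mule_ge0 ?lee_fin.
  under eq_esum do rewrite esumZl ?lee_fin//.
  apply: (@le_trans _ _ (\esum_(g in [set: G]) (alpha g)%:E)); last by rewrite a1.
  apply: le_esum => g _; rewrite -[leRHS]mule1 lee_wpmul2l ?lee_fin//.
have QeF g : Qe g \is a fin_num.
  rewrite ge0_fin_numE//; apply: le_lt_trans (ltry 1%R); apply: le_trans sumQ.
  exact: esum_ge_point.
pose Q g := fine (Qe g).
have Q0 g : (0 <= Q g)%R by rewrite fine_ge0.
have Q1 : \esum_(g in [set: G]) (Q g)%:E <= 1.
  by under eq_esum do rewrite /Q fineK//.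
have Qle1 g : (Q g <= 1)%R by exact: mass_le1.
apply: (le_trans (gibbs bm Q0 Q1)).
rewrite -lawB; last by move=> g; exact: nlog_ge0.
rewrite entropyE// -lawA; last by move=> g; exact: nlog_ge0.
rewrite -(exp_add eJ); try by move=> x; exact: nlog_ge0.
apply: (exp_mono eJ) => x /=; first exact: nlog_ge0.
rewrite -nlogM//; apply: nlog_anti; rewrite -lee_fin /Q fineK// QeE.
have := @esum_ge_point _ _
  (fun p => (alpha p.1)%:E * ((q p.2)%:E * (m p.1 p.2 == B x)%:R%:E)) (A x, D x).
by rewrite /= -BE eqxx mule1 -EFinM; apply => p; exact: t0.
Qed.

End gibbs.
(** * Random words *)

Section words.
Context {R : realType} {G : groupType}.
Implicit Types J : (seq G -> \bar R) -> \bar R.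
Implicit Types (mu rho sigma : G -> R) (u v w : seq G).

Definition prodw w : G := foldr (fun x y => (x * y)%g) 1%g w.

Lemma prodw_cat u v : prodw (u ++ v) = (prodw u * prodw v)%g.
Proof. by elim: u => [|h u IH] /=; rewrite ?mul1g// IH mulgA. Qed.

Fixpoint walk J (n : nat) F : \bar R :=
  if n is m.+1 then walk J m (fun u => J (fun w => F (u ++ w))) else F [::].

Definition letter mu F : \bar R := expect mu (fun h => F [:: h]).

Definition cost (f : G -> \bar R) w : \bar R := \sum_(h <- w) f h.

Lemma walkD J m n F :
  walk J (m + n) F = walk J m (fun u => walk J n (fun v => F (u ++ v))).
Proof.
elim: n F => [|n IH] F.
  by rewrite addn0; congr walk; apply/funext => u /=; rewrite cats0.
rewrite addnS /= IH; congr walk; apply/funext => u; congr walk.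
by apply/funext => v; congr J; apply/funext => w; rewrite catA.
Qed.

Lemma walk_left J n F :
  walk J n.+1 F = J (fun w => walk J n (fun u => F (w ++ u))).
Proof. by rewrite -add1n walkD. Qed.

Lemma walk_expectation J n : is_expectation J -> is_expectation (walk J n).
Proof.
move=> eJ; elim: n => [|n IH].
  by split => [F F' _ ||c F _ _|] /=.
exact: (expectation_bind cat IH (fun=> eJ)).
Qed.

Lemma letter_expectation mu : prob_mass mu -> is_expectation (letter mu).
Proof.
(* With a one-point kernel the binding is a mere transport along [h |-> [:: h]]. *)
move=> mum; apply: (@expectation_bind _ _ _ _ _ (fun _ F => F tt)
  (fun h (_ : unit) => [:: h]) (expect_expectation mum)) => _.
by split => [F F' _ ||c F _ _|] /=.
Qed.

Lemma cost_ge0 f w : (forall h, 0 <= f h) -> 0 <= cost f w.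
Proof. by move=> f0; exact: sume_ge0. Qed.

Lemma cost_cat f u v : cost f (u ++ v) = cost f u + cost f v.
Proof. exact: big_cat. Qed.

Lemma walk_cost mu f k : prob_mass mu -> (forall h, 0 <= f h) ->
  walk (letter mu) k (cost f) = k%:R%:E * expect mu f.
Proof.
move=> mum f0; have eL := letter_expectation mum.
have ef0 : 0 <= expect mu f by exact: exp_ge0 (expect_expectation mum) _ f0.
elim: k => [|k IH]; first by rewrite /= /cost big_nil mul0e.
rewrite -[k.+1%:R%R]natr1 EFinD ge0_muleDl ?lee_fin// mul1e -IH.
have eW := walk_expectation k eL.
rewrite -[X in _ + X](exp_cst eW)// -(exp_add eW)//; last by move=> w; exact: cost_ge0.
rewrite [LHS]/=; congr walk; apply/funext => u.
rewrite -[X in X + _](exp_cst eL)//; last exact: cost_ge0.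
rewrite [expect mu f](_ : _ = letter mu (cost f)); last first.
  by congr expect; apply/funext => h; rewrite /cost big_seq1.
rewrite -(exp_add eL); [|by move=> ?; exact: cost_ge0..].
by congr letter; apply/funext => w; rewrite cost_cat.
Qed.

Lemma expect_conv rho sigma : prob_mass rho -> prob_mass sigma ->
  prob_mass (convolution rho sigma) /\
  forall F : G -> \bar R, (forall g, 0 <= F g) -> expect (convolution rho sigma) F =
    expect rho (fun h => expect sigma (fun k => F (h * k)%g)).
Proof.
move=> rm sm; have [r0 r1] := rm; have [s0 s1] := sm.
pose c g := \esum_(h in [set: G]) (rho h * sigma (h^-1 * g)%g)%:E.
have t0 h g : 0 <= (rho h * sigma (h^-1 * g)%g)%:E.
  by rewrite lee_fin mulr_ge0.
have c0 g : 0 <= c g by exact: esum_ge0.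
(* Stated for the extended values [c g]: [fine] is faithful only once [c g] is finite, and this
   follows from [c1], the case [F = 1]. *)
have cE (F : G -> \bar R) : (forall g, 0 <= F g) -> \esum_(g in [set: G]) c g * F g =
    expect rho (fun h => expect sigma (fun k => F (h * k)%g)).
  move=> F0; transitivity (\esum_(g in [set: G]) \esum_(h in [set: G])
      (rho h * sigma (h^-1 * g)%g)%:E * F g).
    apply: eq_esum => g _; rewrite muleC -esumZl//.
    by apply: eq_esum => h _; rewrite muleC.
  rewrite esum_swap; last by move=> g h; rewrite mule_ge0.
  apply: eq_esum => h _; rewrite -esumZl ?lee_fin//; last first.
    by move=> k; rewrite mule_ge0 ?lee_fin.
  rewrite (@reindex_esum _ _ _ [set: G] [set: G] (fun k => h * k)%g).
    by apply: eq_esum => k _; rewrite mulKg EFinM muleA.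
  split => [//|k l _ _ /mulgI//|k _]; exists (h^-1 * k)%g => //.
  by rewrite mulgA mulgV mul1g.
have eR := expect_expectation rm; have eS := expect_expectation sm.
have c1 : \esum_(g in [set: G]) c g = 1.
  rewrite -(exp_one eR); under eq_esum do rewrite -[c _]mule1.
  rewrite (cE (fun=> 1))//; congr expect; apply/funext => h; exact: exp_one.
have cF g : c g \is a fin_num.
  rewrite ge0_fin_numE//; apply: le_lt_trans (ltry 1%R); rewrite -c1.
  exact: esum_ge_point.
have convE g : (convolution rho sigma g)%:E = c g by exact: fineK (cF g).
split; last first.
  by move=> F F0; rewrite -cE//; apply: eq_esum => g _; rewrite convE.
split; first by move=> g; rewrite -lee_fin convE.
by rewrite -[RHS]c1; apply: eq_esum => g _; rewrite convE.
Qed.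

(** Since [prodw] turns concatenation into the group product, it carries [walk] to convolution
    powers. It serves both for single [mu]-letters and for the stopped word. *)
Lemma conv_pow_walk J rho n : is_expectation J -> prob_mass rho ->
  (forall F : G -> \bar R, (forall g, 0 <= F g) -> J (F \o prodw) = expect rho F) ->
  prob_mass (conv_pow rho n) /\
  forall F : G -> \bar R, (forall g, 0 <= F g) ->
    walk J n (F \o prodw) = expect (conv_pow rho n) F.
Proof.
move=> eJ rm law; elim: n => [|n [IHm IH]].
  have dE (F : G -> \bar R) : 0 <= F 1%g -> expect (dirac_mass 1%g) F = F 1%g.
    move=> F0; rewrite -[RHS]esum_eq_op//; apply: eq_esum => g _.
    by rewrite /dirac_mass eq_sym.
  split; last by move=> F F0; rewrite dE.
  split; first by move=> g; rewrite /= /dirac_mass.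
  by rewrite -[RHS](dE (fun=> 1))//; apply: eq_esum => g _; rewrite mule1.
have [cm cE] := expect_conv IHm rm; split => // F F0 /=.
rewrite cE// -IH; last first.
  by move=> g; apply: exp_ge0 (expect_expectation rm) _ _.
congr walk; apply/funext => u /=; rewrite -law//; congr J.
by apply/funext => w /=; rewrite prodw_cat.
Qed.

(* Completing a [J]-random word [w] by independent letters up to length [k]
   yields the law of [k] independent letters. This expresses that the length of
   [w] is a randomized stopping time. *)
Definition stopping mu J : Prop := forall k (F : seq G -> \bar R), (forall w, 0 <= F w) ->
  J (fun w => walk (letter mu) (k - size w) (fun v => F (take k w ++ v)))
  = walk (letter mu) k F.

(** Wald's identity, as an upper bound, for the part of the word beyond length [k]. All [k] are
    taken together because after a prefix [u] the threshold becomes [k - size u]. *)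
Definition wald mu J (f : G -> \bar R) : Prop := forall k,
  J (fun w => cost f (drop k w))
  <= expect mu f * J (fun w => (size w - k)%:R%:E).

Lemma take_cat_sub k u w : take k (u ++ w) = take k u ++ take (k - size u) w.
Proof.
rewrite take_cat; have [uk|uk] := ltnP; last by rewrite [in RHS]take_oversize.
have -> : (k - size u = 0)%N by lia.
by rewrite take0 cats0.
Qed.

Lemma drop_cat_sub k u w : drop k (u ++ w) = drop k u ++ drop (k - size u) w.
Proof.
rewrite drop_cat; have [uk|uk] := ltnP; last by rewrite [in RHS](@drop_oversize _ _ u).
have -> : (k - size u = 0)%N by lia.
by rewrite drop0.
Qed.

(** After the first words [u], the next one is cut and completed at the remaining length
    [k - size u]; truncated subtraction makes this 0 once [u] is long enough. *)
Lemma stopping_walk mu J n : stopping mu J -> stopping mu (walk J n).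
Proof.
move=> sJ; elim: n => [|n IH] k F F0 /=; first by rewrite subn0.
rewrite -[RHS](IH k)//; congr walk; apply/funext => u.
rewrite -(sJ (k - size u)%N (fun w => F (take k u ++ w)))//.
congr J; apply/funext => w; rewrite size_cat subnDA; congr walk.
by apply/funext => v; rewrite take_cat_sub catA.
Qed.

(** The overshoot of [u ++ w] past [k] is that of [u] past [k] plus that of [w] past [k - size u];
    both the cost and the length split along it. *)
Lemma wald_walk mu J f n : prob_mass mu -> (forall h, 0 <= f h) ->
  is_expectation J -> wald mu J f -> wald mu (walk J n) f.
Proof.
move=> mum f0 eJ wJ; have ef0 : 0 <= expect mu f.
  exact: exp_ge0 (expect_expectation mum) _ f0.
elim: n => [|n IH] k /=.
  by rewrite /cost big_nil mule0.
have eW := walk_expectation n eJ.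
have cst c (F : seq G -> \bar R) : 0 <= c -> (forall w, 0 <= F w) ->
    J (fun w => c + F w) = c + J F.
  by move=> c0 F0; rewrite (exp_add eJ)// (exp_cst eJ).
apply: (@le_trans _ _ (walk J n (fun u => cost f (drop k u)
    + expect mu f * J (fun w => (size w - (k - size u))%:R%:E)))).
  apply: (exp_mono eW) => u; first by apply: exp_ge0 => // w; exact: cost_ge0.
  rewrite (_ : (fun w => _) = (fun w => cost f (drop k u) +
     cost f (drop (k - size u) w))); last first.
    by apply/funext => w; rewrite drop_cat_sub cost_cat.
  rewrite cst//; [|exact: cost_ge0|by move=> w; exact: cost_ge0].
  by rewrite leeD2l.
have J0 u : 0 <= J (fun w => (size w - (k - size u))%:R%:E).
  by apply: exp_ge0 => // w; rewrite lee_fin.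
rewrite (exp_add eW); [|by move=> u; exact: cost_ge0|by move=> u; rewrite mule_ge0].
rewrite (exp_scale eW)//.
apply: (@le_trans _ _ (expect mu f * walk J n (fun w => (size w - k)%:R%:E) +
  expect mu f * walk J n (fun u => J (fun w => (size w - (k - size u))%:R%:E)))).
  by rewrite leeD2r.
rewrite -ge0_muleDr//; [|by apply: exp_ge0 => // w; rewrite lee_fin|exact: exp_ge0].
apply: lee_wpmul2l => //; rewrite -(exp_add eW)//.
apply: (exp_mono eW) => u; first by rewrite adde_ge0 ?lee_fin.
rewrite -cst ?lee_fin//.
apply: (exp_mono eJ) => w; first by rewrite adde_ge0 ?lee_fin.
by rewrite -EFinD lee_fin -natrD ler_nat size_cat; lia.
Qed.

(* Universal subprobability on words: length [l] has weight [2^-(l+1)]. *)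
Definition word_weight mu v : R :=
  (2^-1 ^+ (size v).+1 * \prod_(h <- v) mu h)%R.

Lemma esum_seq (a : seq G -> \bar R) : (forall v, 0 <= a v) ->
  \esum_(v in [set: seq G]) a v =
  a [::] + \esum_(h in [set: G]) \esum_(v in [set: seq G]) a (h :: v).
Proof.
move=> a0; rewrite (esumID [set [::]])// !setTI esum_set1//; congr (_ + _).
rewrite -(esum_pair (a := fun p => a (p.1 :: p.2)))//.
apply: reindex_esum; split => [p _ //|[h v] [h' v'] _ _ [-> ->]//|[|h v] //= ne].
by exists (h, v).

Qed.

Lemma word_weight_ge0 mu v : prob_mass mu -> (0 <= word_weight mu v)%R.
Proof.
by move=> [m0 _]; rewrite mulr_ge0 ?prodr_ge0// exprn_ge0// invr_ge0.
Qed.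

(** For words of length below [N], splitting off the first letter gives total weights with
    [s_(N+1) = 1/2 + s_N / 2], which preserves the bound 1. Every finite set of words lies in such a
    truncation. *)
Lemma esum_word_weight mu : prob_mass mu ->
  \esum_(v in [set: seq G]) (word_weight mu v)%:E <= 1.
Proof.
move=> mum; have [m0 m1] := mum; have r0 := fun v => word_weight_ge0 v mum.
pose a N v := (word_weight mu v)%:E * (size v < N)%N%:R%:E.
have a0 N v : 0 <= a N v by rewrite mule_ge0 ?lee_fin.
have aN N : \esum_(v in [set: seq G]) a N v <= 1.
  elim: N => [|N IH].
    by rewrite esum1// => v _; rewrite /a ltn0 mule0.
  rewrite esum_seq// {1}/a mule1.
  have -> : word_weight mu [::] = (2^-1)%R by rewrite /word_weight big_nil mulr1 expr1.
  have -> : \esum_(h in [set: G]) \esum_(v in [set: seq G]) a N.+1 (h :: v)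
      = \esum_(h in [set: G]) (mu h)%:E *
         ((2^-1)%:E * \esum_(v in [set: seq G]) a N v).
    apply: eq_esum => h _; rewrite -!esumZl ?lee_fin ?invr_ge0//; last first.
      by move=> v; apply: mule_ge0; [rewrite lee_fin invr_ge0|exact: a0].
    apply: eq_esum => v _; rewrite /a /= ltnS /word_weight /= big_cons exprS.
    by rewrite -!EFinM; congr (_%:E); ring.
  apply: (@le_trans _ _ ((2^-1)%:E + \esum_(h in [set: G]) (mu h)%:E * (2^-1)%:E)).
    rewrite leeD2l//; apply: le_esum => h _; rewrite lee_wpmul2l ?lee_fin//.
    by rewrite -[leRHS]mule1 lee_wpmul2l ?lee_fin ?invr_ge0.
  rewrite (_ : \esum_(h in [set: G]) _ = expect mu (fun=> (2^-1)%:E))//.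
  rewrite (exp_cst (expect_expectation mum)) ?lee_fin ?invr_ge0//.
  by lra.
apply: ge_ereal_sup => _ [A [finA _] <-].
have [s As] := (finite_seqP A).1 finA.
pose N := (\max_(v <- s) size v).+1.
apply: le_trans (aN N); apply: esum_ge; exists A => //.
rewrite le_eqVlt; apply/orP; left; apply/eqP; apply: eq_fsbigr => v.
rewrite inE => Av; rewrite /a ltnS leq_bigmax_seq ?mule1//.
by move: Av; rewrite As.
Qed.

(** The information content of a word is additive in its letters up to one [ln 2]; this additivity
    lets Wald's identity bound its mean. *)
Lemma nlog_word_weight mu v : prob_mass mu ->
  nlog (word_weight mu v)
  = (ln 2)%:E + cost (fun h => (ln 2)%:E + nlog (mu h)) v.
Proof.
move=> [m0 _].
have n2 : nlog (2^-1)%R = (ln 2)%:E :> \bar R.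
  by rewrite /nlog invr_gt0 ltr0n lnV ?posrE// opprK.
elim: v => [|h v IH].
  by rewrite /word_weight /cost !big_nil mulr1 expr1 adde0.
have -> : word_weight mu (h :: v) = (2^-1 * mu h * word_weight mu v)%R.
  by rewrite /word_weight /= big_cons exprS; ring.
have w0 : (0 <= word_weight mu v)%R.
  by rewrite mulr_ge0 ?prodr_ge0// exprn_ge0// invr_ge0.
have i2 : (0 <= 2^-1 :> R)%R by rewrite invr_ge0.
rewrite (nlogM (mulr_ge0 i2 (m0 h)) w0) (nlogM i2 (m0 h)) IH n2 /cost big_cons.
by rewrite addeCA.
Qed.

(** * Comparison of the entropies of [rho^{*n}] and [mu^{*k}] *)

Section coupling.
Variables (mu rho : G -> R) (J : (seq G -> \bar R) -> \bar R).
Hypotheses (mum : prob_mass mu) (rhom : prob_mass rho) (eJ : is_expectation J).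
Hypothesis law : forall F : G -> \bar R, (forall g, 0 <= F g) -> J (F \o prodw) = expect rho F.
Hypothesis sJ : stopping mu J.
Let f h := (ln 2)%:E + nlog (mu h).
Hypothesis wJ : wald mu J f.

Let mu_le1 h : (mu h <= 1)%R.
Proof. by have [m0 m1] := mum; apply: mass_le1; rewrite ?m1. Qed.

Let ln2_ge0 : (0 <= ln 2 :> R)%R. Proof. by rewrite ln_ge0// ler1n. Qed.

Let f0 h : 0 <= f h.
Proof. by rewrite adde_ge0 ?lee_fin// nlog_ge0. Qed.

Let letter_law (F : G -> \bar R) : (forall g, 0 <= F g) -> letter mu (F \o prodw) = expect mu F.
Proof. by move=> _; congr expect; apply/funext => h /=; rewrite mulg1. Qed.

(** This is [E|S_n - k|]: one of the truncated differences vanishes, the first being the overshoot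
    [drop k w], the second the number of fresh letters. *)
Definition length_gap n k :=
  walk J n (fun w => ((size w - k) + (k - size w))%:R%:E).

(** One coupling read in both directions: [A] has law [mu^{*k}] by [stopping_walk], [B] has law
    [rho^{*n}], and either is recovered from the other through [D], the pair of removed and added
    words. *)
Lemma entropy_conv_pow_gap n k :
  entropy (conv_pow rho n) <= entropy (conv_pow mu k)
    + ((2 * ln 2)%:E + ((ln 2)%:E + entropy mu) * length_gap n k) /\
  entropy (conv_pow mu k) <= entropy (conv_pow rho n)
    + ((2 * ln 2)%:E + ((ln 2)%:E + entropy mu) * length_gap n k).
Proof.
have eL := letter_expectation mum.
have [am alaw] := conv_pow_walk k eL mum letter_law.
have [bm blaw] := conv_pow_walk n eJ rhom law.
have eW := walk_expectation n eJ.
have eWL j := walk_expectation j eL.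
pose I (Phi : seq G * seq G -> \bar R) := walk J n (fun w =>
  walk (letter mu) (k - size w) (fun v => Phi (w, v))).
have eI : is_expectation I.
  exact: (expectation_bind pair eW (fun w => eWL (k - size w)%N)).
pose A (p : seq G * seq G) := prodw (take k p.1 ++ p.2).
pose B (p : seq G * seq G) := prodw p.1.
pose D (p : seq G * seq G) := (drop k p.1, p.2).
pose r := word_weight mu.
pose q (p : seq G * seq G) := (r p.1 * r p.2)%R.
have r0 v : (0 <= r v)%R by exact: word_weight_ge0.
have q0 p : (0 <= q p)%R by rewrite mulr_ge0.
have q1 : \esum_(p in [set: seq G * seq G]) (q p)%:E <= 1.
  rewrite esum_pair//.
  apply: (@le_trans _ _ (\esum_(u in [set: seq G]) (r u)%:E)); last first.
    exact: esum_word_weight.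
  apply: le_esum => u _; rewrite /q /=; under eq_esum do rewrite EFinM.
  rewrite esumZl ?lee_fin// -[leRHS]mule1.
  by apply: lee_wpmul2l; rewrite ?lee_fin// esum_word_weight.
have lawA (F : G -> \bar R) : (forall g, 0 <= F g) -> I (F \o A) = expect (conv_pow mu k) F.
  move=> F0; rewrite -alaw// -(stopping_walk n sJ)//.
  by move=> w; exact: F0.
have lawB (F : G -> \bar R) : (forall g, 0 <= F g) -> I (F \o B) = expect (conv_pow rho n) F.
  move=> F0; rewrite -blaw//; congr walk; apply/funext => w.
  by apply: (exp_eq_cst (eWL (k - size w)%N)) => //; exact: F0.
have bound : I (fun p => nlog (q (D p)))
    <= (2 * ln 2)%:E + ((ln 2)%:E + entropy mu) * length_gap n k.
  have c0 w : 0 <= cost f w by exact: cost_ge0.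
  (* Each of the two words of [D p] brings one [ln 2], even when it is empty. *)
  have -> : (fun p => nlog (q (D p))) = (fun p => (2 * ln 2)%:E +
     (cost f (drop k p.1) + cost f p.2)).
    apply/funext => p; rewrite nlogM// !nlog_word_weight// addeACA -EFinD.
    by congr (_%:E + _); ring.
  rewrite (exp_add eI)//; last first.
  - by move=> p; rewrite adde_ge0.
  - by move=> p; rewrite lee_fin mulr_ge0.
  rewrite (exp_cst eI) ?lee_fin ?mulr_ge0// leeD2l//.
  rewrite (exp_add eI)//.
  have -> : (ln 2)%:E + entropy mu = expect mu f.
    rewrite (exp_add (expect_expectation mum))//; last first.
      by move=> h; rewrite nlog_ge0.
    by rewrite entropyE// (exp_cst (expect_expectation mum))// lee_fin.
  have Kge0 : 0 <= expect mu f by exact: exp_ge0 (expect_expectation mum) _ f0.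
  have -> : I (fun p => cost f p.2)
      = expect mu f * walk J n (fun w => (k - size w)%:R%:E).
    rewrite -(exp_scale eW)//; congr walk; apply/funext => w.
    by rewrite walk_cost// muleC.
  have -> : I (fun p => cost f (drop k p.1)) = walk J n (fun w => cost f (drop k w)).
    congr walk; apply/funext => w.
    exact: (exp_eq_cst (eWL (k - size w)%N)).
  (* The added letters are independent and fixed in number given [w], so their mean cost was exact;
     the removed ones belong to the stopped walk and need Wald. *)
  apply: le_trans (leeD2r _ (wald_walk n mum f0 eJ wJ k)) _.
  rewrite -ge0_muleDr//; [|exact: exp_ge0..].
  rewrite -(exp_add eW)//; rewrite /length_gap.
  rewrite (_ : (fun w => (_ + _)%:R%:E) =
    fun w => (size w - k)%:R%:E + (k - size w)%:R%:E)//.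
  by apply/funext => w; rewrite natrD EFinD.
have takeE p : prodw (take k p.1) = (A p * (prodw p.2)^-1)%g.
  by rewrite /A prodw_cat mulgK.
have BE p : B p = (prodw (take k p.1) * prodw (drop k p.1))%g.
  by rewrite -prodw_cat cat_take_drop.
split.
  apply: le_trans (entropy_coupling (m := fun g y =>
    (g * (prodw y.2)^-1 * prodw y.1)%g) eI am bm q0 q1 lawA lawB (D := D) _) _.
    by move=> p; rewrite BE takeE.
  by rewrite leeD2l.
apply: le_trans (entropy_coupling (m := fun g y =>
  (g * (prodw y.1)^-1 * prodw y.2)%g) eI bm am q0 q1 lawB lawA (D := D) _) _.
  by move=> p; rewrite BE /= mulgK takeE -mulgA mulVg mulg1.
by rewrite leeD2l.
Qed.

(** Again [entropy_coupling], now with [mu^{*k}] itself as the weight, so that the mean of [nlog] is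
    its entropy. *)
Lemma entropy_conv_powD j k :
  entropy (conv_pow mu (j + k))
  <= entropy (conv_pow mu j) + entropy (conv_pow mu k).
Proof.
have eL := letter_expectation mum.
have [jm jlaw] := conv_pow_walk j eL mum letter_law.
have [km klaw] := conv_pow_walk k eL mum letter_law.
have [jkm jklaw] := conv_pow_walk (j + k) eL mum letter_law.
have kle1 g : (conv_pow mu k g <= 1)%R.
  by have [k0 k1] := km; apply: mass_le1; rewrite ?k1.
pose I (Phi : seq G * seq G -> \bar R) := walk (letter mu) j (fun u =>
  walk (letter mu) k (fun v => Phi (u, v))).
have eWk := walk_expectation k eL; have eWj := walk_expectation j eL.
have eI : is_expectation I.
  exact: (expectation_bind pair eWj (fun=> eWk)).
have [k0 k1] := km.
have := @entropy_coupling _ G _ _ I (conv_pow mu j) (conv_pow mu (j + k))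
  (conv_pow mu k) (fun p => prodw p.1) (fun p => prodw (p.1 ++ p.2))
  (fun p => prodw p.2) (fun g h => (g * h)%g) eI jm jkm k0.
rewrite k1 => /(_ (lexx _)) h.
have -> : entropy (conv_pow mu k) = I (fun p => nlog (conv_pow mu k (prodw p.2))).
  rewrite entropyE// -klaw; last by move=> g; exact: nlog_ge0.
  apply/esym/(exp_eq_cst eWj) => //.
  by apply: exp_ge0 => // v; exact: nlog_ge0.
apply: h => [F F0|F F0|p].
- rewrite -jlaw//; congr walk; apply/funext => u.
  by apply: (exp_eq_cst eWk) => //; exact: F0.
- by rewrite -jklaw// walkD.
- by rewrite prodw_cat.
Qed.

End coupling.
End words.
(** * Law of large numbers in mean *)

Section law_of_large_numbers.
Context {R : realType}.

(** Slope at most 1 in absolute value and second derivative at most [1 / A]: a large [A] flattens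
    the curvature at the price of the value [A] at 0. *)
Let phi (A x : R) : R := Num.sqrt (A ^+ 2 + x ^+ 2).

Let phi_sqr (A x : R) : (phi A x ^+ 2 = A ^+ 2 + x ^+ 2)%R.
Proof. by rewrite sqr_sqrtr// addr_ge0 ?sqr_ge0. Qed.

Let phi_ge_norm (A x : R) : (`|x| <= phi A x)%R.
Proof. by rewrite -sqrtr_sqr ler_wsqrtr// lerDr sqr_ge0. Qed.

Let phi_ge (A x : R) : (0 <= A)%R -> (A <= phi A x)%R.
Proof.
by move=> A0; rewrite -{1}(ger0_norm A0) -sqrtr_sqr ler_wsqrtr// lerDl sqr_ge0.
Qed.

(* Second-order expansion of [phi A], with the quadratic error term used for
   small increments [y] and the Lipschitz bound for large ones. *)
Let phi_small (A x y M : R) : (0 < A)%R -> (`|y| <= M)%R ->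
  (phi A (x + y) <= phi A x + x / phi A x * y + M ^+ 2 / (2 * A))%R.
Proof.
move=> A0 yM; have M0 : (0 <= M)%R by exact: le_trans yM.
have pA := phi_ge x (ltW A0); have p0 := lt_le_trans A0 pA.
have px := phi_sqr A x; have pxy := phi_sqr A (x + y).
set p := phi A x in pA p0 px *; set D := phi A (x + y) in pxy *.
have y2 : (y ^+ 2 <= M ^+ 2)%R by rewrite -(ger0_norm (sqr_ge0 y)) normrX lerXn2r ?nnegrE.
apply: (@le_trans _ _ (p + x / p * y + y ^+ 2 / (2 * p))%R); last first.
  rewrite lerD2l; apply: ler_pM => //; first exact: sqr_ge0.
    by rewrite invr_ge0 mulr_ge0// ltW.
  by rewrite lef_pV2 ?posrE ?mulr_gt0// ler_pM2l.
rewrite -(ler_pM2l (x := 2 * p)) ?mulr_gt0//.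
have -> : (2 * p * (p + x / p * y + y ^+ 2 / (2 * p))
    = 2 * p ^+ 2 + 2 * x * y + y ^+ 2)%R by field; rewrite gt_eqF.
(* [2 p D <= p^2 + D^2], where [D^2 = p^2 + 2 x y + y^2]. *)
have := sqr_ge0 (p - D); nra.
Qed.

(** One [|y|] pays for the Lipschitz bound of [phi A], the other for the linear term, whose slope is
    at most 1. *)
Let phi_large (A x y : R) : (0 < A)%R ->
  (phi A (x + y) <= phi A x + x / phi A x * y + 2 * `|y|)%R.
Proof.
move=> A0; have pA := phi_ge x (ltW A0); have p0 := lt_le_trans A0 pA.
have px := phi_sqr A x; have pxy := phi_sqr A (x + y).
have xp := phi_ge_norm A x.
set p := phi A x in pA p0 px xp *; set D := phi A (x + y) in pxy *.
have Dp : (D <= p + `|y|)%R.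
  rewrite -(@ler_pXn2r _ 2)//; [|by rewrite nnegrE sqrtr_ge0|
    by rewrite nnegrE addr_ge0// ltW].
  rewrite pxy !sqrrD px real_normK ?num_real//.
  have : (x * y <= p * `|y|)%R.
    apply: le_trans (ler_norm _) _; rewrite normrM ler_wpM2r//.
  by lra.
have : (- `|y| <= x / p * y)%R.
  rewrite lerNl -mulNr; apply: le_trans (ler_norm _) _.
  rewrite normrM normrN ler_piMl// normrM normfV (ger0_norm (ltW p0)).
  by rewrite ler_pdivrMr// mul1r.
by lra.
Qed.

(** If [i <= M] the increment [i - m] lies in [[-M, M]]; if [i > M >= m] it is at most [i], which is
    charged to the tail of the mean length. *)
Let phi_step (A x m M : R) (i : nat) : (0 < A)%R -> (0 <= m <= M)%R ->
  (phi A (x + (i%:R - m)) <= phi A x + x / phi A x * (i%:R - m)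
     + (M ^+ 2 / (2 * A) + 2 * (i%:R * (M < i%:R)%R%:R)))%R.
Proof.
move=> A0 /andP[m0 mM]; have i0 : (0 <= i%:R :> R)%R by [].
case: ltP => iM; last first.
  by rewrite mulr0 mulr0 addr0; apply: phi_small => //; rewrite ler_norml; lra.
apply: le_trans (phi_large _ _ A0) _; rewrite lerD2l mulr1.
have c0 : (0 <= M ^+ 2 / (2 * A))%R by rewrite divr_ge0 ?sqr_ge0 ?mulr_ge0 ?ltW.
have : (`|i%:R - m| <= i%:R)%R by rewrite ler_norml; lra.
by lra.
Qed.

Let phi_slope (A x : R) : (0 < A)%R -> (`|x / phi A x| <= 1)%R.
Proof.
move=> A0; have p0 := lt_le_trans A0 (phi_ge x (ltW A0)).
by rewrite normrM normfV (ger0_norm (ltW p0)) ler_pdivrMr// mul1r phi_ge_norm.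
Qed.

Context {G : groupType}.

(** A finite set of words carries the mean up to [e]; [M] dominates all lengths occurring in it, so
    words longer than [M] share what remains. *)
Lemma expect_tail (a : seq G -> R) (m e : R) : is_mass a ->
  expect a (fun w => (size w)%:R%:E) = m%:E -> (0 < e)%R ->
  exists2 M : R, (m <= M)%R &
    expect a (fun w => ((size w)%:R * (M < (size w)%:R)%R%:R)%:E) <= e%:E.
Proof.
move=> am aE e0; have [a0 _] := am; have eE := expect_expectation am.
have : m%:E - e%:E < expect a (fun w => (size w)%:R%:E).
  by rewrite aE -EFinB lte_fin ltrBlDr ltrDl.
move=> /ereal_sup_gt[_ [B [finB _] <-] le1].
have [s Bs] := (finite_seqP B).1 finB.
pose N := (\max_(v <- s) size v)%N.
pose M : R := Num.max m N%:R.
exists M; first by rewrite le_max lexx.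
pose lo (w : seq G) : \bar R := ((size w)%:R * (~~ (M < (size w)%:R)%R)%:R)%:E.
pose hi (w : seq G) : \bar R := ((size w)%:R * (M < (size w)%:R)%R%:R)%:E.
have lo0 w : 0 <= lo w by rewrite lee_fin mulr_ge0.
have hi0 w : 0 <= hi w by rewrite lee_fin mulr_ge0.
have split : expect a (fun w => (size w)%:R%:E) = expect a lo + expect a hi.
  rewrite -(exp_add eE)//; congr expect; apply/funext => w.
  by rewrite -EFinD -mulrDr; case: ltP; rewrite ?addr0 ?add0r mulr1.
have lo_ge : m%:E - e%:E <= expect a lo.
  apply: le_trans (ltW le1) _; apply: esum_ge; exists B => //.
  rewrite le_eqVlt; apply/orP; left; apply/eqP; apply: eq_fsbigr => w.
  rewrite inE Bs/= => ws; rewrite /lo -leNgt.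
  rewrite (_ : (_ <= M)%R) ?mulr1// le_max; apply/orP; right.
  by rewrite ler_nat leq_bigmax_seq.
have lof : expect a lo \is a fin_num.
  rewrite ge0_fin_numE; last exact: exp_ge0.
  by apply: (@le_lt_trans _ _ m%:E); rewrite ?ltry// -aE split leeDl// exp_ge0.
have hif : expect a hi \is a fin_num.
  rewrite ge0_fin_numE; last exact: exp_ge0.
  by apply: (@le_lt_trans _ _ m%:E); rewrite ?ltry// -aE split leeDr// exp_ge0.
move: split lo_ge; rewrite aE -/hi -(fineK lof) -(fineK hif) -EFinD -EFinB.
by move=> [->]; rewrite !lee_fin; lra.
Qed.

(* [phi] is a smooth proxy for the absolute value: its expectation grows per
   step by at most the second-order error term, which is small in mean. *)
Lemma walk_size_lln (a : seq G -> R) (m e : R) : is_mass a -> (0 <= m)%R ->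
  expect a (fun w => (size w)%:R%:E) = m%:E -> (0 < e)%R ->
  exists A : R, forall n,
    walk (expect a) n (fun w => `|(size w)%:R - n%:R * m|%:E)
    <= (A + n%:R * e)%:E.
Proof.
move=> am m0 aE e0; have eE := expect_expectation am.
have e4 : (0 < e / 4)%R by rewrite divr_gt0.
have [M mM tail] := expect_tail am aE e4.
have M0 : (0 <= M)%R by exact: le_trans mM.
(* Makes the curvature term [M^2 / (2 A)] at most [e / 2], with [A > 0] even if [M = 0]; the tail
   [e / 4], counted twice, gives the other half. *)
pose A := (M ^+ 2 / e + 1)%R.
have Me0 : (0 <= M ^+ 2 / e)%R by rewrite divr_ge0 ?sqr_ge0 ?ltW.
have A0 : (0 < A)%R by rewrite ltr_wpDl.
have C_le : (M ^+ 2 / (2 * A) <= e / 2)%R.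
  rewrite ler_pdivrMr ?mulr_gt0//.
  have -> : (e / 2 * (2 * A) = M ^+ 2 + e)%R by rewrite /A; field; rewrite gt_eqF.
  by rewrite lerDl ltW.
have phi0 x : 0 <= (phi A x)%:E by rewrite lee_fin sqrtr_ge0.
have step (x : R) : expect a (fun w => (phi A (x + ((size w)%:R - m)))%:E)
    <= (phi A x + e)%:E.
  have sl := phi_slope x A0; set s := (x / phi A x)%R in sl.
  have [s1 s2] : (0 <= 1 - s)%R /\ (0 <= 1 + s)%R.
    by move: sl; rewrite ler_norml; lra.
  pose T (w : seq G) : \bar R := ((size w)%:R * (M < (size w)%:R)%R%:R)%:E.
  have T0 w : 0 <= T w by rewrite lee_fin mulr_ge0.
  have sz0 w : 0 <= (size w)%:R%:E :> \bar R by rewrite lee_fin.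
  (* The linear term [s (size w - m)] has mean 0 but no sign. Adding [(1 - s) size w + (1 + s) m] to
     both sides makes every summand nonnegative; the means then differ from the wanted ones by [2 m]
     on each side. *)
  have mono : expect a (fun w => (phi A (x + ((size w)%:R - m)))%:E +
      ((1 - s)%:E * (size w)%:R%:E + ((1 + s) * m)%:E)) <=
    expect a (fun w => (phi A x + m + e / 2)%:E + ((size w)%:R%:E + 2%:E * T w)).
    apply: (exp_mono eE) => w.
      by rewrite !adde_ge0// ?mule_ge0 ?lee_fin ?mulr_ge0.
    rewrite -!EFinM -!EFinD lee_fin.
    have := @phi_step A x m M (size w) A0; rewrite m0 mM => /(_ isT).
    rewrite -/s; set P := phi A (x + _); set Q := (_%:R * _)%R.
    by move: (M ^+ 2 / _)%R C_le => C; lra.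
  move: mono; rewrite (exp_add eE)//; last first.
    by move=> w; rewrite adde_ge0 ?mule_ge0 ?lee_fin ?mulr_ge0.
  rewrite (exp_add eE)//; [|by move=> w; rewrite mule_ge0 ?lee_fin|
    by move=> w; rewrite lee_fin mulr_ge0].
  rewrite (exp_scale eE) ?lee_fin// aE (exp_cst eE) ?lee_fin ?mulr_ge0//.
  have c0 : (0 <= phi A x + m + e / 2)%R.
    by have := phi0 x; rewrite lee_fin; lra.
  rewrite (exp_add eE); [|by move=> w; rewrite lee_fin|
    by move=> w; rewrite adde_ge0 ?mule_ge0].
  rewrite (exp_cst eE) ?lee_fin// (exp_add eE)//; last first.
    by move=> w; rewrite mule_ge0.
  rewrite (exp_scale eE)// aE => mono.
  have {}mono := le_trans mono (leeD2l _ (leeD2l _ (lee_wpmul2l _ tail))).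
  have : expect a (fun w => (phi A (x + ((size w)%:R - m)))%:E) + (2 * m)%:E
      <= (phi A x + e + 2 * m)%:E.
    have two0 : 0 <= 2%:E :> \bar R by rewrite lee_fin.
    apply: le_trans (le_trans _ (mono two0)) _.
      by rewrite -EFinM -EFinD leeD2l// lee_fin; lra.
    by rewrite -!EFinM -!EFinD lee_fin; lra.
  by rewrite EFinD leeD2rE.
exists A => n; have eW := walk_expectation n eE.
apply: (@le_trans _ _ (walk (expect a) n
    (fun w => (phi A ((size w)%:R - n%:R * m))%:E))).
  by apply: (exp_mono eW) => w; rewrite lee_fin// phi_ge_norm.
elim: n {eW} => [|n IH].
  rewrite /= mul0r mul0r subr0 addr0 lee_fin /phi expr0n addr0 sqrtr_sqr.
  by rewrite ger0_norm// ltW.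
have eW := walk_expectation n eE; rewrite [leLHS]/=.
apply: (@le_trans _ _ (walk (expect a) n
    (fun w => (phi A ((size w)%:R - n%:R * m))%:E + e%:E))).
  apply: (exp_mono eW) => u; first by apply: exp_ge0 => // w.
  apply: le_trans (step _); apply: (exp_mono eE) => // w.
  rewrite size_cat natrD lee_fin le_eqVlt; apply/orP; left; apply/eqP.
  by congr phi; rewrite -natr1; ring.
rewrite (exp_add eW)//; last by move=> w; rewrite lee_fin ltW.
rewrite (exp_cst eW) ?lee_fin ?(ltW e0)//; apply: le_trans (leeD2r _ IH) _.
by rewrite -EFinD lee_fin -natr1; lra.
Qed.

End law_of_large_numbers.
(** * Subadditive sequences *)

Section subadditive_sequences.
Context {R : realType}.
Implicit Types u v : nat -> R.

(** Euclidean division [n = q d + r]: the remainder costs at most [d u(1) + u(0)], where [u(0)]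
    covers [r = 0]. *)
Lemma subadditive_bound u d n : (forall n, (0 <= u n)%R) ->
  (forall j k, (u (j + k)%N <= u j + u k)%R) -> (0 < d)%N -> (0 < n)%N ->
  (u n / n%:R <= u d / d%:R + (d%:R * u 1%N + u 0%N) / n%:R)%R.
Proof.
move=> u0 sub d0 n0.
have mulq q k : (u (q * k)%N <= q%:R * u k + u 0%N)%R.
  elim: q => [|q IH]; first by rewrite mul0n mul0r add0r.
  by rewrite mulSn; apply: le_trans (sub _ _) _; rewrite -natr1; lra.
have big q k : (0 < q)%N -> (u (q * k)%N <= q%:R * u k)%R.
  case: q => // q _; elim: q => [|q IH]; first by rewrite mul1n mul1r.
  by rewrite mulSn; apply: le_trans (sub _ _) _; rewrite -natr1; lra.
have nE := divn_eq n d; have rd := ltn_pmod n d0.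
set q := (n %/ d)%N in nE; set r := (n %% d)%N in nE rd.
have ur : (u r <= d%:R * u 1%N + u 0%N)%R.
  have := mulq r 1%N; rewrite muln1.
  have : (r%:R * u 1%N <= d%:R * u 1%N)%R.
    by rewrite ler_wpM2r// ler_nat ltnW.
  by lra.
have uqd : (u (q * d)%N <= q%:R * u d + (if q == 0%N then u 0%N else 0))%R.
  by case: eqP => [->|/eqP q0]; rewrite ?mulq// addr0 big// lt0n.
have d0' : (0 < d%:R :> R)%R by rewrite ltr0n.
have n0' : (0 < n%:R :> R)%R by rewrite ltr0n.
rewrite ler_pdivrMr// mulrDl divfK ?gt_eqF//.
have -> : (u d / d%:R * n%:R = q%:R * u d + r%:R * u d / d%:R)%R.
  by rewrite {1}nE natrD natrM; field; rewrite gt_eqF.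
have rud : (0 <= r%:R * u d / d%:R)%R by rewrite divr_ge0 ?mulr_ge0.
case: (posnP q) => [q0|q0].
  have -> : n = r by rewrite nE q0.
  have : (0 <= q%:R * u d)%R by rewrite mulr_ge0.
  by lra.
rewrite {1}nE; apply: le_trans (sub _ _) _.
by have := big q d q0; lra.
Qed.

(** The limit is the infimum of the ratios over positive indices. *)
Lemma fekete u : (forall n, (0 <= u n)%R) ->
  (forall j k, (u (j + k)%N <= u j + u k)%R) ->
  exists h : R, (fun n => (u n / n%:R)%R) @ \oo --> h.
Proof.
move=> u0 sub.
pose S := [set (u n / n%:R)%R | n in [set n | (0 < n)%N]].
have infS : has_inf S.
  split; first by exists (u 1%N / 1%:R)%R, 1%N.
  by exists 0%R => _ [n _ <-]; rewrite divr_ge0.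
exists (inf S); apply/cvgrPdist_le => e e0.
have e2 : (0 < e / 2)%R by rewrite divr_gt0.
have [_ [d /= d0 <-] lt_d] := inf_adherent e2 infS.
pose c := (d%:R * u 1%N + u 0%N)%R.
have c0 : (0 <= c)%R by rewrite addr_ge0 ?mulr_ge0.
near=> n.
have n0 : (0 < n)%N by near: n; exact: nbhs_infty_gt.
have lo : (inf S <= u n / n%:R)%R by apply: ge_inf; [exact: infS.2|exists n].
rewrite ler_norml; apply/andP; split; last by lra.
have hi := subadditive_bound u0 sub d0 n0; rewrite -/c in hi.
have : (c / n%:R <= e / 2)%R.
  rewrite ler_pdivrMr ?ltr0n// mulrC -ler_pdivrMr//.
  by near: n; exact: nbhs_infty_ger.
by lra.
Unshelve. all: by end_near. Qed.

(** Take for [k n] the integer part of [n m]: then [|k n - n m| <= 1], so [v n - u (k n)] is [o(n)],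
    and [u (k n) / n] factors as [(k n / n) (u (k n) / k n)]. *)
Lemma cvg_time_change u v (h m K : R) : (0 < m)%R -> (0 <= K)%R ->
  (fun n => (u n / n%:R)%R) @ \oo --> h ->
  (forall e : R, (0 < e)%R -> exists B : R, forall n k : nat,
     (`|v n - u k| <= B + n%:R * e + K * `|k%:R - n%:R * m|)%R) ->
  (fun n => (v n / n%:R)%R) @ \oo --> (m * h)%R.
Proof.
move=> m0 K0 uh close.
pose k n := Num.truncn (n%:R * m)%R.
have kn n : ((k n)%:R <= n%:R * m < (k n).+1%:R)%R.
  by apply: truncn_itv; rewrite mulr_ge0// ltW.
have kd n : (`|(k n)%:R - n%:R * m| <= 1 :> R)%R.
  by have /andP[] := kn n; rewrite -natr1 ler_norml; lra.
have km : (fun n => ((k n)%:R / n%:R)%R) @ \oo --> m.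
  apply/cvgrPdist_le => e e0; near=> n.
  have n0 : (0 < n%:R :> R)%R by rewrite ltr0n; near: n; exact: nbhs_infty_gt.
  have -> : (m - (k n)%:R / n%:R = - ((k n)%:R - n%:R * m) / n%:R)%R.
    by field; rewrite gt_eqF.
  rewrite normrM normrN normfV (ger0_norm (ltW n0)).
  apply: (@le_trans _ _ (1 / n%:R)%R); first by rewrite ler_pM2r ?invr_gt0.
  rewrite ler_pdivrMr// mulrC -ler_pdivrMr//.
  by near: n; exact: nbhs_infty_ger.
have kinf : k @ \oo --> \oo.
  apply/cvgnyPge => N; near=> n.
  have /andP[_] := kn n; rewrite -natr1.
  have : (N%:R + 1 <= n%:R * m)%R.
    by rewrite -ler_pdivrMr//; near: n; exact: nbhs_infty_ger.
  by move=> h1 h2; rewrite -(ler_nat R); lra.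
have uk : (fun n => (u (k n) / n%:R)%R) @ \oo --> (m * h)%R.
  have prod : (fun n => ((k n)%:R / n%:R * (u (k n) / (k n)%:R))%R) @ \oo
      --> (m * h)%R.
    have ukk : (fun n => (u (k n) / (k n)%:R)%R) @ \oo --> h.
      exact: (cvg_comp k (fun n => (u n / n%:R)%R) kinf uh).
    exact: (cvgM km ukk).
  apply: cvg_trans prod; apply: near_eq_cvg; near=> n.
  have k0 : (0 < (k n)%:R :> R)%R.
    rewrite ltr0n; near: n; exact: (kinf _ (nbhs_infty_gt 0%N)).
  have n0 : (0 < n%:R :> R)%R by rewrite ltr0n; near: n; exact: nbhs_infty_gt.
  by field; rewrite !gt_eqF.
apply/cvgrPdist_le => e e0.
have e4 : (0 < e / 4)%R by rewrite divr_gt0.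
have [B Bn] := close _ e4.
near=> n.
have n0 : (0 < n%:R :> R)%R by rewrite ltr0n; near: n; exact: nbhs_infty_gt.
have d1 : (`|m * h - u (k n) / n%:R| <= e / 2)%R.
  by near: n; move/cvgrPdist_le: uk; apply; rewrite divr_gt0.
have d2 : (`|v n / n%:R - u (k n) / n%:R| <= e / 2)%R.
  rewrite -mulrBl normrM normfV (ger0_norm (ltW n0)) ler_pdivrMr//.
  apply: le_trans (Bn n (k n)) _.
  have : (K * `|(k n)%:R - n%:R * m| <= K)%R by rewrite ler_piMr.
  have : (B + K <= e / 4 * n%:R)%R.
    rewrite mulrC -ler_pdivrMr//; near: n; exact: nbhs_infty_ger.
  by lra.
have -> : (m * h - v n / n%:R = (m * h - u (k n) / n%:R)
    - (v n / n%:R - u (k n) / n%:R))%R by ring.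
by apply: le_trans (ler_normB _ _) _; lra.
Unshelve. all: by end_near. Qed.

End subadditive_sequences.
(** * Discrete random elements *)

Section discrete_random_elements.
Context {R : realType}.

(** A bare injection transfers to words and pairs without putting a countable structure on [G]. *)
Definition nat_codable (X : Type) : Prop := exists f : X -> nat, injective f.

Lemma nat_codable_nat : nat_codable nat.
Proof. by exists id. Qed.

Lemma nat_codable_seq X : nat_codable X -> nat_codable (seq X).
Proof.
move=> [f fI]; exists (fun s => pickle [seq f x | x <- s]).
exact: inj_comp (pcan_inj pickleK) (inj_map fI).
Qed.

Lemma nat_codable_pair X Y :
  nat_codable X -> nat_codable Y -> nat_codable (X * Y).
Proof.
move=> [f fI] [g gI]; exists (fun p => pickle (f p.1, g p.2)).
by move=> [x y] [x' y'] /(pcan_inj pickleK)[/fI -> /gI ->].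
Qed.

Lemma countable_nat_codable (X : Type) :
  countable [set: X] -> nat_codable X.
Proof.
move=> /countable_injP[f fI]; exists f => x y; apply: fI; exact: in_setT.
Qed.

Context {d : measure_display} {T : measurableType d}.

(** Measurability for the discrete sigma-algebra, without equipping [X] with one; on a codable [X]
    the fibres determine all preimages. *)
Definition fibres_measurable (X : Type) (Z : T -> X) : Prop :=
  forall z, measurable (Z @^-1` [set z]).

Section fibres.
Context {X : Type} (Z : T -> X).
Hypotheses (cX : nat_codable X) (mZ : fibres_measurable Z).

Lemma fibres_preimage (Y : set X) : measurable (Z @^-1` Y).
Proof.
have [f fI] := cX.
have -> : Z @^-1` Y = \bigcup_n (Z @^-1` [set z | Y z /\ f z = n]).
  by apply/seteqP; split => [x Yx|x [n _ []]//]; exists (f (Z x)).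
apply: bigcup_measurable => n _.
have [[z [Yz fz]]|no] := pselect (exists z, Y z /\ f z = n).
  rewrite (_ : [set z | _] = [set z])//; apply/seteqP; split => [z' [_]|z' ->//].
  by rewrite -fz => /fI ->.
rewrite (_ : [set z | _] = set0) ?preimage_set0//.
by apply/seteqP; split => // z Hz; apply: no; exists z.
Qed.

Lemma fibres_comp (Y : Type) (g : X -> Y) : fibres_measurable (g \o Z).
Proof. by move=> y; exact: (fibres_preimage (g @^-1` [set y])). Qed.

Lemma fibres_measurable_fun D (F : X -> \bar R) : measurable_fun D (F \o Z).
Proof.
by move=> mD Y _; apply: measurableI => //; exact: (fibres_preimage (F @^-1` Y)).
Qed.

End fibres.

Lemma fibres_pair X Y (Z : T -> X) (Z' : T -> Y) :
  fibres_measurable Z -> fibres_measurable Z' ->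
  fibres_measurable (fun x => (Z x, Z' x)).
Proof.
move=> mZ mZ' [z z'].
rewrite (_ : _ @^-1` _ = Z @^-1` [set z] `&` Z' @^-1` [set z']).
  exact: measurableI.
by apply/seteqP; split => x /= => [[-> ->]//|[-> ->]].
Qed.

Lemma integral_discrete (P : {measure set T -> \bar R}) (X : choiceType)
    (Z : T -> X) (C : set T) (F : X -> \bar R) :
  nat_codable X -> fibres_measurable Z -> measurable C -> (forall z, 0 <= F z) ->
  \int[P]_(x in C) F (Z x)
  = \esum_(z in [set: X]) P (C `&` Z @^-1` [set z]) * F z.
Proof.
move=> cX mZ mC F0; have [f fI] := cX.
pose A n := C `&` Z @^-1` [set z | f z = n].
have mA n : measurable (A n).
  by apply: measurableI => //; exact: fibres_preimage.
have CE : C = \bigcup_n A n.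
  by apply/seteqP; split => [x Cx|x [n _ []]//]; exists (f (Z x)).
have intA z : \int[P]_(x in A (f z)) F (Z x) = P (C `&` Z @^-1` [set z]) * F z.
  have -> : A (f z) = C `&` Z @^-1` [set z].
    by rewrite /A; congr (_ `&` (_ @^-1` _)); apply/seteqP; split => [y /fI|y ->].
  have mCz : measurable (C `&` Z @^-1` [set z]) by exact: measurableI.
  rewrite muleC -integral_cst//; apply: eq_integral => x.
  by rewrite inE => -[_ ->].
rewrite [in LHS]CE ge0_integral_bigcup//; last 2 first.
- rewrite -CE; exact: (fibres_measurable_fun cX mZ).
- apply/trivIsetP => i j _ _ ij; apply/seteqP; split => // x [[_ /= ei] [_ /= ej]].
  by rewrite -ei -ej eqxx in ij.
rewrite nneseries_esumT; last by move=> n; exact: integral_ge0.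
under [RHS]eq_esum do rewrite -intA.
rewrite -(@esum_image _ _ _ [set: X] f
  (fun n => \int[P]_(x in A n) F (Z x))); last by move=> ? ? _ _ /fI.
rewrite [RHS]esum_mkcond; apply: eq_esum => n _; case: ifPn => // nf.
rewrite (_ : A n = set0) ?integral_set0//; apply/seteqP; split => // x [_ /= fx].
by move/negP: nf; apply; rewrite inE; exists (Z x).
Qed.

End discrete_random_elements.

(** * The extended chain and stopping times *)

Section extended_chain.
Context {R : realType} {G : groupType} {d : measure_display}
  {Omega : measurableType d}.
Local Notation path := (ext_path G Omega).
(** The filtration at time [s] as a measurable type, so that the closure lemmas for measurable sets
    apply to it. *)
Local Notation past s := (g_sigma_algebraType
  (\bigcup_(n in [set n | (n <= s)%N]) path_coord_events n)).
Variables (mu : G -> R) (theta : probability Omega R) (P : probability path R).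
Hypotheses (cG : nat_codable G) (mum : prob_mass mu).
Hypothesis markov : markov_law (ext_init theta) (ext_transition mu theta) P.

Definition position i (x : path) : G := (x i).1.

Definition increment i (x : path) : G :=
  ((position i x)^-1 * position i.+1 x)%g.

(** [history s.+1] lists the positions 0 to [s]: it is what is known at time [s], and it determines
    [word s]. *)
Definition history n (x : path) : seq G := mkseq (position^~ x) n.

Definition word n (x : path) : seq G := mkseq (increment^~ x) n.

Lemma position_event s i g : (i <= s)%N ->
  path_filtration s [set x | position i x = g].
Proof.
move=> is_; apply: sub_sigma_algebra; exists i => //.
exists ([set (g : discrete_group G)] `*` [set: Omega]).
  exact: measurableX.
by rewrite setTI; apply/seteqP; split => x /= => [[]|].
Qed.

Lemma path_filtration_measurable s (C : set path) :
  path_filtration s C -> measurable C.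
Proof. by apply: sub_sigma_algebra2 => A [n _ An]; exists n. Qed.

Lemma history_event s n v : (n <= s.+1)%N ->
  path_filtration s [set x | history n x = v].
Proof.
elim: n v => [|n IH] v ns.
  case: v => [|g v].
    rewrite (_ : [set x | _] = setT); last by apply/seteqP; split.
    exact: (@measurableT _ (past s)).
  rewrite (_ : [set x | _] = set0); last by apply/seteqP; split.
  exact: (@measurable0 _ (past s)).
case/lastP: v => [|v g].
  rewrite (_ : [set x | _] = set0); last by apply/seteqP; split.
  exact: (@measurable0 _ (past s)).
rewrite (_ : [set x | _] =
  [set x | history n x = v] `&` [set x | position n x = g]).
  apply: (@measurableI _ (past s)).
    exact: IH (ltnW ns).
  exact: position_event.
apply/seteqP; split => x; rewrite /history /= mkseqS.
  by move=> /rcons_inj[].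
by move=> [-> ->].
Qed.

Lemma history_fibres n : fibres_measurable (history n).
Proof.
move=> v; apply: (@path_filtration_measurable n); exact: history_event.
Qed.

Lemma increment_fibres n : fibres_measurable (increment n).
Proof.
have -> : increment n = (fun v => (nth 1 v n)^-1 * nth 1 v n.+1)%g \o history n.+2.
  by apply/funext => x; rewrite /comp /history !nth_mkseq.
exact: fibres_comp (nat_codable_seq cG) (history_fibres n.+2) _ _.
Qed.

Lemma word_fibres n : fibres_measurable (word n).
Proof.
have -> : word n = (fun v => mkseq (fun i => (nth 1 v i)^-1 * nth 1 v i.+1)%g n)
    \o history n.+1.
  apply/funext => x; apply/eq_in_map => i; rewrite mem_iota add0n => /andP[_ ilt].
  by rewrite /history !nth_mkseq// ltnW.
exact: fibres_comp (nat_codable_seq cG) (history_fibres n.+1) _ _.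
Qed.

Lemma dirac_product_slice (a b : discrete_group G) :
  (\d_a \x theta)%E ([set b] `*` [set: Omega]) = (a == b)%:R%:E.
Proof.
rewrite product_measure1E//; transitivity (\d_a [set b] * 1 : \bar R).
  by congr (_ * _); exact: probability_setT.
rewrite mule1 diracE.
by have -> : (a \in [set b]) = (a == b) by apply/idP/eqP; rewrite inE.
Qed.

(** On [x_s = g] the transition probability into the slice over [g h] is the constant [mu h], left
    multiplication being injective. *)
Lemma markov_step s C g h : path_filtration s C ->
  P (C `&` [set x | position s x = g] `&` [set x | position s.+1 x = (g * h)%g])
  = P (C `&` [set x | position s x = g]) * (mu h)%:E.
Proof.
move=> FC; have [m0 _] := mum.
pose B := [set ((g * h)%g : discrete_group G)] `*` [set: Omega].
have mB : measurable B by exact: measurableX.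
have FCg : path_filtration s (C `&` [set x | position s x = g]).
  apply: (@measurableI _ (past s)) => //.
  exact: position_event.
have := markov.2 s _ B FCg mB.
rewrite (_ : path_coord s.+1 @^-1` B = [set x | position s.+1 x = (g * h)%g]); last first.
  by apply/seteqP; split => x /= => [[]|].
move=> ->; rewrite muleC -integral_cst; last exact: path_filtration_measurable FCg.
apply: eq_integral => x; rewrite inE => -[_ /= xg].
rewrite /ext_transition -[RHS](@esum_set1 _ _ h (fun k => (mu k)%:E)) ?lee_fin//.
rewrite [RHS]esum_mkcond; apply: eq_esum => k _.
rewrite dirac_product_slice.
have -> : (k \in [set h]) = (k == h) by apply/idP/eqP; rewrite inE.
have -> : (x s).1 = g by exact: xg.
have -> : (((g * k)%g : discrete_group G) == (g * h)%g) = (k == h).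
  exact: (inj_eq (mulgI g)).
by case: (k == h); rewrite ?mule1 ?mule0.
Qed.

Lemma position0 : P [set x | position 0 x != 1%g] = 0.
Proof.
pose B := [set (1%g : discrete_group G)] `*` [set: Omega].
have mB : measurable B by exact: measurableX.
have mB0 : measurable [set x : path | position 0 x = 1%g].
  exact: path_filtration_measurable (position_event _ (leq0n 0)).
have := markov.1 B mB.
rewrite (_ : path_coord 0 @^-1` B = [set x | position 0 x = 1%g]); last first.
  by apply/seteqP; split => x /= => [[]|].
rewrite /ext_init dirac_product_slice eqxx => P1.
rewrite (_ : [set x | _] = ~` [set x | position 0 x = 1%g]).
  by rewrite probability_setC// P1 subee.
by apply/seteqP; split => x /= /eqP.
Qed.

(** The next increment is [mu]-distributed and independent of the past; each pair of values [(v, h)]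
    is an instance of [markov_step], with [g] the last entry of [v]. *)
Lemma one_step s C (f : seq G -> G -> \bar R) :
  (forall v h, 0 <= f v h) -> path_filtration s C ->
  \int[P]_(x in C) f (history s.+1 x) (increment s x)
  = \int[P]_(x in C) expect mu (f (history s.+1 x)).
Proof.
move=> f0 FC; have [m0 _] := mum; have mC := path_filtration_measurable FC.
have cS := nat_codable_seq cG.
have ef0 v : 0 <= expect mu (f v) by exact: exp_ge0 (expect_expectation mum) _ _.
rewrite (integral_discrete P (Z := fun x => (history s.+1 x, increment s x))
  (F := fun p => f p.1 p.2) (nat_codable_pair cS cG))//; last first.
  by apply: fibres_pair; [exact: history_fibres|exact: increment_fibres].
rewrite (integral_discrete P (F := fun v => expect mu (f v)) cS (history_fibres s.+1))//.
rewrite esum_pair; last by move=> p; rewrite mule_ge0.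
apply: eq_esum => v _; rewrite -esumZl//; last first.
  by move=> h; rewrite mule_ge0 ?lee_fin.
apply: eq_esum => h _; rewrite muleA; congr (_ * _) => /=.
pose g := nth 1%g v s.
have FCv : path_filtration s (C `&` history s.+1 @^-1` [set v]).
  apply: (@measurableI _ (past s)) => //.
  exact: history_event.
have vg x : history s.+1 x = v -> position s x = g.
  by rewrite /g => <-; rewrite nth_mkseq.
have := @markov_step s _ g h FCv.
rewrite (_ : C `&` _ `&` [set x | position s x = g] = C `&` history s.+1 @^-1` [set v]).
  move=> <-; congr (P _); apply/seteqP; split => x /=.
    move=> [Cx [hv ih]]; split => //.
    by rewrite -ih /increment (vg _ hv) mulgA mulgV mul1g.
  move=> [[Cx hv] ih]; split => //; congr pair => //.
  by rewrite /increment ih (vg _ hv) mulgA mulVg mul1g.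
by apply/seteqP; split => x /= => [[]//|[Cx hv]]; split => //; exact: vg.
Qed.

(** * The word of increments up to the stopping time *)

Section stopped.
Variable tau : path -> \bar R.
Hypothesis st : randomized_stopping_time P tau.

Let mtau : measurable_fun setT tau. Proof. by have [] := st. Qed.

Let tau_values x : tau x = +oo \/ exists2 s : nat, (0 < s)%N & tau x = s%:R%:E.
Proof. by have [_ + _ _] := st; apply. Qed.

Let tau_ge0 x : 0 <= tau x.
Proof. by have [->|[s _ ->]] := tau_values x; rewrite ?leey ?lee_fin. Qed.

(** Takes the default value 0 where [tau] is infinite, so the stopped word is empty there. *)
Definition steps (x : path) : nat := Num.truncn (fine (tau x)).

Lemma stepsE x s : tau x = s%:R%:E -> steps x = s.
Proof. by rewrite /steps => -> /=; exact: natrK. Qed.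

Lemma steps_infinite x : tau x = +oo -> steps x = 0%N.
Proof. by rewrite /steps => ->; rewrite /= truncn0. Qed.

Definition never : set path := tau @^-1` [set +oo].

Lemma never_measurable : measurable never.
Proof.
by rewrite -[never]setTI; exact: mtau (measurableT) _ (emeasurable_set1 _).
Qed.

Lemma never_null : P never = 0.
Proof.
have [_ _ fin _] := st; apply: measure_negligible; first exact: never_measurable.
by apply: negligibleS fin => x; rewrite /never /= => ->; rewrite ltxx.
Qed.

Lemma tauE x : ~ never x -> tau x = (steps x)%:R%:E.
Proof.
move=> nx; have [//|[s _ e]] := tau_values x.
by rewrite (stepsE e).
Qed.

Lemma steps_fibres : fibres_measurable steps.
Proof.
move=> n; rewrite (_ : _ @^-1` _ = (tau @^-1` [set n%:R%:E])
    `|` (if n == 0%N then never else set0)).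
  apply: measurableU; last by case: eqP => // _; exact: never_measurable.
  by rewrite -[X in measurable X]setTI; exact: mtau (measurableT) _ (emeasurable_set1 _).
apply/seteqP; split => x /=.
  have [e|ne] := pselect (never x).
    by rewrite (steps_infinite e) => <- /=; right.
  by move=> <-; left; rewrite -tauE.
move=> [/stepsE//|]; case: eqP => // -> e; exact: steps_infinite.
Qed.

Definition running j : set path := [set x | (j < steps x)%N].

(** The event [tau > j], infinite values included: it is decided at time [j]. [running j] differs
    from it by the null set [never], which need not be decided by then. *)
Definition running_event j : set path :=
  ~` \bigcup_(s in [set s | (0 < s <= j)%N]) tau @^-1` [set s%:R%:E].

Lemma running_event_filtration j : path_filtration j (running_event j).
Proof.
have [_ _ _ ev] := st.
apply: (@measurableC _ (past j)).
apply: (@bigcup_measurable _ (past j)) => s /andP[s0 sj].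
apply: sub_sigma_algebra2 (ev s s0) => A [n /= ns An].
by exists n => //=; exact: leq_trans ns sj.
Qed.

Lemma running_eventE j : running j = running_event j `\` never.
Proof.
apply/seteqP; split => x; rewrite /running /running_event /=.
  move=> js; have nx : ~ never x by move=> e; rewrite steps_infinite in js.
  split => // -[s /andP[s0 sj]] /stepsE e.
  by rewrite e ltnNge sj in js.
move=> [ev nx]; rewrite ltnNge; apply/negP => sj; apply: ev.
exists (steps x); last exact: tauE.
have [//|[s s0 e]] := tau_values x.
by move: sj; rewrite /= (stepsE e) s0.
Qed.

Lemma running_measurable j : measurable (running j).
Proof.
rewrite running_eventE; apply: measurableD; last exact: never_measurable.
exact: path_filtration_measurable (@running_event_filtration j).
Qed.

Lemma one_step_running j (f : seq G -> G -> \bar R) : (forall v h, 0 <= f v h) ->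
  \int[P]_(x in running j) f (history j.+1 x) (increment j x)
  = \int[P]_(x in running j) expect mu (f (history j.+1 x)).
Proof.
move=> f0; have FC := @running_event_filtration j.
have mC := path_filtration_measurable FC; have cS := nat_codable_seq cG.
have ef0 v : 0 <= expect mu (f v) by exact: exp_ge0 (expect_expectation mum) _ _.
rewrite running_eventE -!ge0_negligible_integral//; first exact: one_step.
all: try exact: never_measurable.
all: try exact: never_null.
- exact: (fibres_measurable_fun cS (history_fibres j.+1) (fun v => expect mu (f v))).
- exact: (fibres_measurable_fun (nat_codable_pair cS cG)
    (fibres_pair (history_fibres j.+1) (increment_fibres j)) (fun p => f p.1 p.2)).
Qed.

Definition stopped_word (x : path) : seq G := word (steps x) x.

Lemma stopped_word_fibres : fibres_measurable stopped_word.
Proof.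
move=> w; rewrite (_ : _ @^-1` _ =
  steps @^-1` [set size w] `&` word (size w) @^-1` [set w]).
  by apply: measurableI; [exact: steps_fibres|exact: word_fibres].
apply/seteqP; split => x /=; rewrite /stopped_word.
  by move=> <-; rewrite /word size_mkseq.
by move=> [-> ->].
Qed.

Definition word_mass (w : seq G) : R := fine (P (stopped_word @^-1` [set w])).

Lemma word_massE F : (forall w, 0 <= F w) ->
  expect word_mass F = \int[P]_x F (stopped_word x).
Proof.
move=> F0.
rewrite (integral_discrete P (nat_codable_seq cG) stopped_word_fibres)//.
apply: eq_esum => w _; rewrite setTI /word_mass fineK//.
exact: fin_num_measure (stopped_word_fibres w).
Qed.

Lemma word_mass_is_mass : is_mass word_mass.
Proof.
split; first by move=> w; rewrite fine_ge0.
transitivity (expect word_mass (fun=> 1)).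
  by apply: eq_esum => w _; rewrite mule1.
rewrite word_massE// integral_cst// mul1e; exact: probability_setT.
Qed.

Lemma mean_steps : expect word_mass (fun w => (size w)%:R%:E) = \int[P]_x tau x.
Proof.
rewrite word_massE; last by move=> w; rewrite lee_fin.
apply: ge0_ae_eq_integral => //.
- exact: (fibres_measurable_fun (nat_codable_seq cG) stopped_word_fibres
    (fun w => (size w)%:R%:E)).
exists never; split; [exact: never_measurable|exact: never_null|].
move=> x /= /not_implyP[_ ne]; apply: contrapT => nx; apply: ne.
by rewrite /stopped_word /word size_mkseq (tauE nx).
Qed.

(** Interpolation: [Phi j] reads the path up to [min tau j] and completes with independent letters
    to length [k]. [Phi 0] is the pure walk, [Phi k] the completed stopped word, and the integral
    does not change from [j] to [j + 1]. *)
Lemma stopping_word_mass : stopping mu (expect word_mass).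
Proof.
move=> k F F0; have eL := letter_expectation mum; have cS := nat_codable_seq cG.
have eW j := walk_expectation j eL.
have wF0 j (g : seq G -> seq G) : 0 <= walk (letter mu) j (fun v => F (g v)).
  exact: exp_ge0.
rewrite word_massE//.
pose Phi j x := walk (letter mu) (k - minn (steps x) j)
  (fun v => F (word (minn (steps x) j) x ++ v)).
pose wd (v : seq G) := mkseq (fun i => (nth 1 v i)^-1 * nth 1 v i.+1)%g (size v).-1.
have wdE j x : word j x = wd (history j.+1 x).
  rewrite /wd size_mkseq; apply/eq_in_map => i; rewrite mem_iota add0n => /andP[_ ilt].
  by rewrite !nth_mkseq// ltnW.
have take_word i j x : word (minn i j) x = take i (word j x).
  by rewrite /word /mkseq -map_take take_iota.
have mPhi j D : measurable_fun D (Phi j).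
  pose Psi (p : seq G * nat) := walk (letter mu) (k - minn p.2 j)
    (fun v => F (take p.2 (wd p.1) ++ v)).
  have -> : Phi j = Psi \o (fun x => (history j.+1 x, steps x)).
    by apply/funext => x; rewrite /Phi /Psi /= -wdE -take_word.
  apply: fibres_measurable_fun; first exact: nat_codable_pair nat_codable_nat.
  by apply: fibres_pair; [exact: history_fibres|exact: steps_fibres].
have split j' j : \int[P]_x Phi j' x =
    \int[P]_(x in running j) Phi j' x + \int[P]_(x in ~` running j) Phi j' x.
  have mr := running_measurable j.
  rewrite -[in LHS](setUv (running j)) ge0_integral_setU//.
  - exact: measurableC.
  - by move=> x _; exact: wF0.
  - by apply/disj_set2P; exact: setICr.
have const j : (j <= k)%N -> \int[P]_x Phi j x = walk (letter mu) k F.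
  elim: j => [|j IH] jk.
    rewrite (_ : Phi 0%N = cst (walk (letter mu) k F)).
      by rewrite integral_cst//= probability_setT mule1.
    by apply/funext => x; rewrite /Phi minn0 subn0.
  rewrite -(IH (ltnW jk)) (split j.+1 j) (split j j); congr (_ + _); last first.
    apply: eq_integral => x; rewrite inE /running /= => /negP; rewrite -leqNgt => sj.
    by rewrite /Phi (minn_idPl sj) (minn_idPl (leqW sj)).
  (* Off [running j] nothing changes. On it, the true increment [j] replaces the first independent
     letter, which [walk_left] exposes; [one_step_running] says that both have the same law given
     the past. *)
  pose f u h := walk (letter mu) (k - j.+1) (fun v => F (wd u ++ [:: h] ++ v)).
  transitivity (\int[P]_(x in running j) f (history j.+1 x) (increment j x)).
    apply: eq_integral => x; rewrite inE /running /= => js.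
    rewrite /Phi (minn_idPr js) /f -wdE; congr walk; apply/funext => v.
    by rewrite catA /word mkseqS cats1.
  rewrite one_step_running; last by move=> u h; exact: wF0.
  apply: eq_integral => x; rewrite inE /running /= => js.
  rewrite /Phi (minn_idPr (ltnW js)) -(subnSK jk) walk_left /f -wdE.
  by [].
rewrite -(const k (leqnn k)); apply: eq_integral => x _.
rewrite /Phi minnC take_word -/(stopped_word x).
rewrite (_ : (k - size _ = k - minn k (steps x))%N)//.
by rewrite /stopped_word /word size_mkseq; lia.
Qed.

Lemma cost_drop_word (f : G -> \bar R) k n x :
  cost f (drop k (word n x)) = \sum_(k <= i < n) f (increment i x).
Proof.
by rewrite /cost /word /mkseq -map_drop drop_iota add0n big_map.
Qed.

(** The core of Wald's identity: the increment [i] is counted when [tau > i], an event decided at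
    time [i] and hence independent of it. *)
Lemma integral_cost (f : G -> \bar R) k : (forall h, 0 <= f h) ->
  \int[P]_x cost f (drop k (stopped_word x))
  = \sum_(i <oo) (k <= i)%N%:R%:E * (expect mu f * P (running i)).
Proof.
move=> f0; have ef0 : 0 <= expect mu f by exact: exp_ge0 (expect_expectation mum) _ f0.
pose g i (x : path) : \bar R := (k <= i < steps x)%N%:R%:E * f (increment i x).
have g0 i x : 0 <= g i x by rewrite mule_ge0 ?lee_fin.
have mg i : measurable_fun setT (g i).
  have -> : g i = (fun p => (k <= i < p.1)%N%:R%:E * f p.2)
    \o (fun x => (steps x, increment i x)) by [].
  apply: fibres_measurable_fun; first exact: nat_codable_pair nat_codable_nat cG.
  by apply: fibres_pair; [exact: steps_fibres|exact: increment_fibres].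
transitivity (\int[P]_x (\sum_(i <oo) g i x)).
  apply: eq_integral => x _; rewrite cost_drop_word.
  rewrite (nneseries_split 0 (steps x))// add0n.
  rewrite [X in _ + X]eseries0 ?adde0; last first.
    by move=> i si _; rewrite /g [(i < _)%N]ltnNge si andbF mul0e.
  rewrite (big_nat_widenl k 0)// big_mkcond !big_nat; apply: eq_bigr => i /andP[_ ilt].
  by rewrite /g ilt andbT /=; case: leqP => _; rewrite ?mul1e ?mul0e.
rewrite integral_nneseries//; apply: eq_eseriesr => i _.
case: (leqP k i) => ki; last first.
  rewrite mul0e; apply: integral0_eq => x _.
  by rewrite /g leqNgt ki mul0e.
rewrite mul1e -integral_cst; last exact: running_measurable.
have := @one_step_running i (fun _ h => f h) (fun _ => f0) => <-.
rewrite [RHS]integral_mkcond; apply: eq_integral => x _.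
rewrite patchE /g ki /=; case: ifPn; rewrite /running.
  by rewrite inE /= => ->; rewrite mul1e.
by rewrite notin_setE /= => /negP/negbTE ->; rewrite mul0e.
Qed.

Lemma wald_word_mass f : (forall h, 0 <= f h) -> expect mu f < +oo ->
  wald mu (expect word_mass) f.
Proof.
move=> f0 fF k; have ef0 : 0 <= expect mu f.
  exact: exp_ge0 (expect_expectation mum) _ f0.
have eF : expect mu f \is a fin_num by rewrite ge0_fin_numE.
rewrite word_massE; last by move=> w; exact: cost_ge0.
rewrite word_massE; last by move=> w; rewrite lee_fin.
rewrite integral_cost//.
(* The excess length is the cost with unit price per letter, so [integral_cost] evaluates both sides
   as the same series. *)
have -> : (fun x => (size (stopped_word x) - k)%:R%:E : \bar R)
    = (fun x => cost (fun=> 1) (drop k (stopped_word x))).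
  apply/funext => x; rewrite -size_drop /cost.
  by elim: (drop _ _) => [|h v IH]; rewrite ?big_nil// big_cons -IH /= -natr1 addrC EFinD.
rewrite integral_cost// (exp_one (expect_expectation mum)).
rewrite -(fineK eF) -nneseriesZl//; last by move=> i _; rewrite mul1e mule_ge0 ?lee_fin.
apply: lee_nneseries => i _; first by rewrite !mule_ge0 ?lee_fin ?fine_ge0.
by rewrite mul1e muleCA.
Qed.

(** The product of the increments telescopes to the final position once [x_0] is the identity; the
    paths with another start or with infinite [tau] form the null set [N]. *)
Lemma word_mass_law F : (forall g, 0 <= F g) ->
  expect word_mass (F \o prodw) = expect (stopped_mass P tau) F.
Proof.
move=> F0; have cS := nat_codable_seq cG.
rewrite word_massE; last by move=> w; exact: F0.
have mZ := fibres_comp cS stopped_word_fibres (@prodw G).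
rewrite (integral_discrete P cG mZ)//.
apply: eq_esum => g _; congr (_ * _); rewrite setTI.
have prod_word n x : position 0 x = 1%g -> prodw (word n x) = position n x.
  move=> x0; elim: n => [|n IH]; first by rewrite x0.
  rewrite /word mkseqS -cats1 prodw_cat -/(word n x) IH /= mulg1 /increment.
  by rewrite mulgA mulgV mul1g.
pose E := [set x : path | exists2 s : nat, tau x = s%:R%:E & (x s).1 = g].
have mE : measurable E.
  rewrite (_ : E = \bigcup_s ((tau @^-1` [set s%:R%:E]) `&` [set x | position s x = g])).
    apply: bigcup_measurable => s _; apply: measurableI.
      rewrite -[X in measurable X]setTI; exact: mtau (measurableT) _ (emeasurable_set1 _).
    exact: path_filtration_measurable (position_event _ (leqnn s)).
  by apply/seteqP; split => x /= [s]; [move=> *; exists s|move=> _ [*]; exists s].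
pose N := never `|` [set x | position 0 x != 1%g].
have mN0 : measurable [set x : path | position 0 x != 1%g].
  rewrite (_ : [set x | _] = ~` [set x | position 0 x = 1%g]).
    apply: measurableC.
    exact: path_filtration_measurable (position_event _ (leq0n 0)).
  by apply/seteqP; split => x /= /eqP.
have mN : measurable N by apply: measurableU => //; exact: never_measurable.
have PN : P N = 0.
  by apply: null_set_setU => //; [exact: never_measurable|exact: never_null|exact: position0].
have mA := mZ g.
have diffN A : measurable A -> P A = P (A `\` N).
  move=> mA'; rewrite -[LHS]mul1e -[RHS]mul1e -!integral_cst//; last exact: measurableD.
  exact: ge0_negligible_integral.
rewrite /stopped_mass fineK; last exact: fin_num_measure mE.
apply: (eq_trans (diffN _ mA)); apply: (eq_trans _ (esym (diffN _ mE))).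
congr (P _).
apply/seteqP; split => x /= [ex nx]; split => //.
  have nv : ~ never x by move=> e; apply: nx; left.
  have x0 : position 0 x = 1%g.
    by apply/eqP; apply: contrapT => /negP e; apply: nx; right.
  exists (steps x); first exact: tauE.
  by rewrite -ex /stopped_word prod_word.
have x0 : position 0 x = 1%g.
  by apply/eqP; apply: contrapT => /negP e; apply: nx; right.
move: ex => [s e <-].
by rewrite /stopped_word prod_word// (stepsE e).
Qed.

End stopped.
End extended_chain.
(** * Asymptotic entropy *)

Section limits.
Context {R : realType} {G : groupType}.
Implicit Types mu rho : G -> R.

Lemma entropy_ge0 rho : prob_mass rho -> 0 <= entropy rho.
Proof.
move=> rm; have [r0 r1] := rm; rewrite entropyE//.
apply: exp_ge0 (expect_expectation rm) _ _ => g.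
by apply: nlog_ge0; apply: mass_le1; rewrite ?r1.
Qed.

Lemma entropy_dirac : entropy (dirac_mass (1%g : G) : G -> R) = 0.
Proof.
apply: esum1 => g _; rewrite /dirac_mass; case: eqP => _.
  by rewrite ln1 mulr0 oppr0.
by rewrite mul0r oppr0.
Qed.

Lemma conv_pow1 mu : prob_mass mu -> conv_pow mu 1 = mu.
Proof.
move=> [m0 _]; apply/funext => g; rewrite /= /convolution.
rewrite (eq_esum (b := fun h => (1%g == h)%:R%:E * (mu (h^-1 * g)%g)%:E)).
  by rewrite esum_eq_op ?lee_fin// invg1 mul1g.
by move=> h _; rewrite /dirac_mass eq_sym EFinM.
Qed.

Lemma conv_pow_mass rho n : prob_mass rho -> prob_mass (conv_pow rho n).
Proof.
move=> rm; apply: (conv_pow_walk n (letter_expectation rm) rm _).1 => F _.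
by congr expect; apply/funext => h /=; rewrite mulg1.
Qed.

Lemma entropy_conv_pow_fin mu k : prob_mass mu -> entropy mu < +oo ->
  entropy (conv_pow mu k) \is a fin_num.
Proof.
move=> mum muF; elim: k => [|k IH]; first by rewrite /= entropy_dirac.
rewrite ge0_fin_numE; last exact/entropy_ge0/conv_pow_mass.
rewrite -addn1; apply: le_lt_trans (entropy_conv_powD mum _ _) _.
by rewrite conv_pow1// lte_add_pinfty// ltey_eq IH.
Qed.

Lemma asymptotic_entropy_lim rho (u : nat -> R) (h : R) :
  (forall n, entropy (conv_pow rho n) = (u n)%:E) ->
  (fun n => (u n / n%:R)%R) @ \oo --> h -> asymptotic_entropy rho = h%:E.
Proof.
move=> uE uh; rewrite /asymptotic_entropy.
rewrite (_ : (fun n => _) = EFin \o (fun n => (u n / n%:R)%R)).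
  apply/cvg_lim => //; apply/fine_cvgP; split; last exact: uh.
  exact: nearW.
by apply/funext => n /=; rewrite uE -EFinM mulrC.
Qed.

Lemma length_gap_le (J : (seq G -> \bar R) -> \bar R) n k (c : R) :
  is_expectation J ->
  length_gap J n k <= walk J n (fun w => `|(size w)%:R - c|%:E) + `|k%:R - c|%:E.
Proof.
move=> eJ; have eW := walk_expectation n eJ.
rewrite -[X in _ + X](exp_cst eW)// -(exp_add eW)//.
apply: (exp_mono eW) => w; first by rewrite lee_fin.
rewrite -EFinD lee_fin.
have -> : ((size w - k + (k - size w))%:R = `|(size w)%:R - k%:R| :> R)%R.
  case: (leqP k (size w)) => sk.
    have -> : (k - size w = 0)%N by lia.
    by rewrite addn0 natrB// ger0_norm// subr_ge0 ler_nat.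
  have -> : (size w - k = 0)%N by lia.
  by rewrite add0n natrB 1?ltnW// distrC ger0_norm// subr_ge0 ler_nat ltnW.
have -> : ((size w)%:R - k%:R = ((size w)%:R - c) - (k%:R - c) :> R)%R by ring.
exact: ler_normB.
Qed.

End limits.
Theorem theorem2p6 (R : realType) (G : groupType) (mu : G -> R)
    (d : measure_display) (Omega : measurableType d)
    (theta : probability Omega R) (P : probability (ext_path G Omega) R)
    (tau : ext_path G Omega -> \bar R) :
  countable [set: G] ->
  prob_mass mu ->
  entropy mu < +oo ->
  lebesgue_space theta ->
  markov_law (ext_init theta) (ext_transition mu theta) P ->
  randomized_stopping_time P tau ->
  \int[P]_x tau x < +oo ->
  asymptotic_entropy (stopped_mass P tau)
    = (\int[P]_x tau x) * asymptotic_entropy mu.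
Proof.
move=> /countable_nat_codable cG mum muF _ markov st tauF.
pose rho := stopped_mass P tau; pose a := word_mass P tau; pose J := expect a.
have am : is_mass a := word_mass_is_mass cG st.
have eJ : is_expectation J := expect_expectation am.
have law (F : G -> \bar R) : (forall g, 0 <= F g) -> J (F \o prodw) = expect rho F.
  exact: (word_mass_law cG markov st).
have rhom : prob_mass rho.
  split; first by move=> g; rewrite fine_ge0.
  transitivity (expect rho (fun=> 1)); first by apply: eq_esum => g _; rewrite mule1.
  by rewrite -law//; exact: exp_one.
have [m0 m1] := mum.
have mu_le1 h : (mu h <= 1)%R by apply: mass_le1; rewrite ?m1.
pose f h := (ln 2)%:E + nlog (mu h).
have ln2_ge0 : (0 <= ln 2 :> R)%R by rewrite ln_ge0// ler1n.
have f0 h : 0 <= f h by rewrite adde_ge0 ?lee_fin// nlog_ge0.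
have fE : expect mu f = (ln 2)%:E + entropy mu.
  rewrite (exp_add (expect_expectation mum))//; last by move=> h; rewrite nlog_ge0.
  by rewrite entropyE// (exp_cst (expect_expectation mum)).
have muf : entropy mu \is a fin_num by rewrite ge0_fin_numE// entropy_ge0.
pose K := (ln 2 + fine (entropy mu))%R.
have KE : (ln 2)%:E + entropy mu = K%:E by rewrite -(fineK muf).
have K0 : (0 <= K)%R by rewrite addr_ge0// fine_ge0// entropy_ge0.
have sJ : stopping mu J := stopping_word_mass cG mum markov st.
have wJ : wald mu J f.
  by apply: (wald_word_mass cG mum markov st) => //; rewrite fE KE ltry.
(* Stopping times start at 1, so the mean [m] is positive, as the time change requires. *)
have tau0 x : 1 <= tau x.
  have [_ tv _ _] := st.
  by have [->|[s s0 ->]] := tv x; rewrite ?leey// lee_fin ler1n.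
have m_ge1 : 1 <= \int[P]_x tau x.
  have <- : \int[P]_x (cst 1) x = 1.
    by rewrite integral_cst// mul1e; exact: probability_setT.
  apply: ge0_le_integral => //; last by have [] := st.
have mf : \int[P]_x tau x \is a fin_num.
  by rewrite ge0_fin_numE//; exact: le_trans m_ge1.
pose m := fine (\int[P]_x tau x).
have mE : \int[P]_x tau x = m%:E by rewrite fineK.
have m_gt0 : (0 < m)%R by move: m_ge1; rewrite mE lee_fin; exact: lt_le_trans.
have aE : J (fun w => (size w)%:R%:E) = m%:E by rewrite -mE; exact: mean_steps.
have gap e : (0 < e)%R -> exists A : R, forall n k,
    length_gap J n k <= (A + n%:R * e + `|k%:R - n%:R * m|)%:E.
  move=> e0; have [A HA] := walk_size_lln am (ltW m_gt0) aE e0.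
  exists A => n k; apply: le_trans (length_gap_le n k (n%:R * m) eJ) _.
  by rewrite EFinD leeD2r.
have coupled := entropy_conv_pow_gap mum rhom eJ law sJ wJ.
have uF k := entropy_conv_pow_fin k mum muF.
(* Finiteness comes from the comparison itself at [k = 0], where the power of [mu] is a Dirac
   mass. *)
have vF n : entropy (conv_pow rho n) \is a fin_num.
  rewrite ge0_fin_numE; last exact/entropy_ge0/conv_pow_mass.
  have [A HA] := gap 1%R ltr01.
  apply: le_lt_trans (coupled n 0%N).1 _; rewrite KE.
  apply: lte_add_pinfty; first by rewrite ltey_eq uF.
  apply: lte_add_pinfty; first exact: ltry.
  apply: le_lt_trans (lee_wpmul2l _ (HA n 0%N)) _; first by rewrite lee_fin.
  by rewrite -EFinM ltry.
pose u k := fine (entropy (conv_pow mu k)).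
pose v n := fine (entropy (conv_pow rho n)).
have uE k : entropy (conv_pow mu k) = (u k)%:E by rewrite fineK.
have vE n : entropy (conv_pow rho n) = (v n)%:E by rewrite fineK.
have u0 k : (0 <= u k)%R by apply/fine_ge0/entropy_ge0/conv_pow_mass.
have usub j k : (u (j + k)%N <= u j + u k)%R.
  by rewrite -lee_fin EFinD -!uE; exact: entropy_conv_powD.
have [h uh] := fekete u0 usub.
have close e : (0 < e)%R -> exists B : R, forall n k : nat,
    (`|v n - u k| <= B + n%:R * e + K * `|k%:R - n%:R * m|)%R.
  move=> e0; have K1 : (0 < K + 1)%R by lra.
  (* The gap is multiplied by [K] in the entropy bound, and [K * (e / (K + 1)) <= e]. *)
  have [A HA] := gap (e / (K + 1))%R (divr_gt0 e0 K1).
  exists (2 * ln 2 + K * A)%R => n k.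
  have KHA := lee_wpmul2l (_ : 0 <= K%:E) (HA n k).
  have [] := coupled n k; rewrite KE uE vE.
  move=> /le_trans/(_ (leeD2l _ (leeD2l _ (KHA _)))) h1.
  move=> /le_trans/(_ (leeD2l _ (leeD2l _ (KHA _)))) h2.
  have K0' : 0 <= K%:E by rewrite lee_fin.
  move: (h1 K0') (h2 K0'); rewrite -!EFinM -!EFinD !lee_fin.
  have : (K * (n%:R * (e / (K + 1))) <= n%:R * e)%R.
    rewrite mulrCA ler_wpM2l// mulrA ler_pdivrMr// mulrC ler_wpM2l ?ltW//.
    by lra.
  by rewrite !mulrDr ler_norml; lra.
rewrite (asymptotic_entropy_lim uE uh) mE -EFinM.
exact: asymptotic_entropy_lim vE (cvg_time_change m_gt0 K0 uh close).
Qed.
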